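(* Let $V:\mathbb{R}\to\mathbb{R}$ be a non-negative $C^3$ function. For $p\in\Omega$ let $O^-(p)$ denote the past orbit of $p$ under the flow (with time parameter $\tau$) of the scalar field system with potential $V$. Then for almost every $p\in\Omega$ (i.e. for all $p$ outside a subset of $\Omega$ of measure zero) the function $\phi$ is unbounded on $O^-(p)$.
   Context: Given a non-negative potential $V$, the spatially flat FRW scalar field cosmologies are the solutions of $$\frac{d\phi}{dt}=\dot\phi,\qquad \frac{d\dot\phi}{dt}=-K\dot\phi-V'(\phi),\qquad \frac{dK}{dt}=-\tfrac32\dot\phi^2,$$ subject to the constraint $K^2=3V(\phi)+\tfrac32\dot\phi^2$ (which is preserved by the evolution). The phase space of expanding solutions is the 2-dimensional set $$\Omega=\{(K,\phi,\dot\phi)\in\mathbb{R}^3: K>0,\ K^2=3V(\phi)+\tfrac32\dot\phi^2\},$$ which is invariant; it is parametrized by $(\phi,\dot\phi)$ ranging over $\{(\phi,\dot\phi)\in\mathbb{R}^2 : 3V(\phi)+\tfrac32\dot\phi^2>0\}$ (with $K=\sqrt{3V(\phi)+\tfrac32\dot\phi^2}$), and ''measure zero'' refers to Lebesgue measure in the coordinates $(\phi,\dot\phi)$. Put $x=1/K$, $y=\sqrt{3/2}\,\dot\phi/K$ and introduce the new time $\tau$ by $\frac{d}{dt}=K\frac{d}{d\tau}$. Then the system becomes $$\frac{dx}{d\tau}=y^2x,\qquad \frac{dy}{d\tau}=-y-\sqrt{\tfrac32}\,x^2V'(\phi)+y^3,\qquad \frac{d\phi}{d\tau}=\sqrt{\tfrac23}\,y,$$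 subject to $y^2+3x^2V(\phi)=1$. The past orbit $O^-(p)$ is the set of points reached from $p$ at times $\tau\le 0$. *)

(* Defs.v *)
From HB Require Import structures.
From mathcomp Require Import all_boot all_order all_algebra.
From mathcomp Require Import all_classical all_reals all_analysis.
Set Implicit Arguments.
Unset Strict Implicit.
Unset Printing Implicit Defensive.
Import Order.TTheory GRing.Theory Num.Theory numFieldNormedType.Exports.
Local Open Scope classical_set_scope.
Local Open Scope ring_scope.

Definition Ck (R : realType) (k : nat) (f : R -> R) : Prop :=
  (forall i : nat, (i < k)%N -> forall s : R, derivable (derive1n i f) s 1) /\
  continuous (derive1n k f).

(* A point of the (K, phi, dphi/dt) space. *)
Record state (R : realType) := State {
  hubble : R;
  scalar_field : R;
  field_velocity : R }.

Definition Omega (R : realType) (V : R -> R) : set (state R) :=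
  [set p | 0 < hubble p /\
    hubble p ^+ 2 =
      3 * V (scalar_field p) + 3 / 2 * field_velocity p ^+ 2].

(* On Omega the projection to (phi, dphi/dt) is injective, since K is the
   positive root of the constraint: it is the chart in which null sets are
   taken. *)
Definition chart (R : realType) (p : state R) : R * R :=
  (scalar_field p, field_velocity p).

Definition measure_zero (R : realType) (N : set (state R)) : Prop :=
  (@lebesgue_measure R \x @lebesgue_measure R)%E.-negligible
    (@chart R @` N).

(* The variables (x, y, phi) with x = 1 / K, y = sqrt (3/2) (dphi/dt) / K. *)
Definition normalized (R : realType) (p : state R) : R * R * R :=
  ((hubble p)^-1,
   Num.sqrt (3 / 2) * field_velocity p / hubble p,
   scalar_field p).

(* The system in the time tau, where d/dt = K d/dtau. *)
Definition tau_solution (R : realType) (V : R -> R) (I : set R)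
    (x y phi : R -> R) : Prop :=
  forall s : R, I s ->
    [/\ is_derive s 1 x (y s ^+ 2 * x s),
        is_derive s 1 y
          (- y s - Num.sqrt (3 / 2) * x s ^+ 2 * derive1 V (phi s) + y s ^+ 3),
        is_derive s 1 phi (Num.sqrt (2 / 3) * y s)
      & y s ^+ 2 + 3 * x s ^+ 2 * V (phi s) = 1].

(* No completeness of the flow is built in: q is reached from p at the time
   tau <= 0 when some solution on an open interval containing 0 and tau passes
   through p at 0 and through q at tau. *)
Definition past_orbit (R : realType) (V : R -> R) (p : state R) :
    set (state R) :=
  [set q | Omega V q /\
    exists (a b tau : R) (x y phi : R -> R),
      [/\ a < tau, tau <= 0, 0 < b,
          tau_solution V `]a, b[ x y phi
        & (x 0, y 0, phi 0) = normalized p /\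
          (x tau, y tau, phi tau) = normalized q]].

(* Main.v *)
Require Import Defs.
From HB Require Import structures.
From mathcomp Require Import all_boot all_order all_algebra.
From mathcomp Require Import all_classical all_reals all_analysis.
From mathcomp Require Import measurable_realfun ring lra.
Set Implicit Arguments.
Unset Strict Implicit.
Unset Printing Implicit Defensive.
Import Order.TTheory GRing.Theory Num.Theory numFieldNormedType.Exports.
Local Open Scope classical_set_scope.
Local Open Scope ring_scope.

(* If phi stays bounded on the past orbit of p, then so does K: otherwise
   x = 1 / K tends to 0 along it, the constraint forces y^2 >= 1/2 from some
   time backwards, and phi' = sqrt (2/3) y makes phi unbounded.  Hence, in the
   time t, the past trajectory of p in the (phi, phi') plane exists for all
   t <= 0 and stays in a set |phi| <= n, 1/n <= K <= n, and the set S_n of all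
   such points p satisfies S_n = Psi (S') with S' contained in S_n, where Psi is
   the time T map.  The divergence of the vector field (u, - K u - V' (phi)) is at
   most - K <= - 1/n, so for small T the map Psi contracts areas by a factor < 1,
   and |S_n| <= |Psi (S')| < |S_n| unless S_n is null.

   The contraction of area does not use the differentiability of the flow.  Psi is
   decomposed as (phi, u) -> (phi, U) -> (Phi, U), each of the two maps moving one
   coordinate only; their one-dimensional Lipschitz constants, 1 - T/n + O(T^2)
   and 1 + O(T^2), are obtained by comparing two trajectories, and Fubini's theorem
   turns them into a bound of the area. *)

(** * Real functions and the Picard theorem *)

Section calculus.
Context {R : realType}.
Implicit Types (f g h df : R -> R) (a b c s t x : R).

Lemma is_derive_continuous f x a : is_derive x 1 f a -> {for x, continuous f}.
Proof. by case=> df _; exact/differentiable_continuous/derivable1_diffP. Qed.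

Lemma mvt f df a b : a < b ->
  (forall x, a <= x <= b -> is_derive x 1 f (df x)) ->
  exists2 c, a < c < b & f b - f a = df c * (b - a).
Proof.
move=> ab fdf; have [|x|c cab fE] := @MVT R f df a b ab.
- by move=> x; rewrite in_itv/= => /andP[ac cb]; apply: fdf; rewrite !ltW.
- apply: continuous_in_subspaceT => {}x; rewrite inE/= in_itv/= => axb.
  exact: is_derive_continuous (fdf x axb).
- by exists c => //; move: cab; rewrite in_itv.
Qed.

Lemma derive_ge0_le f df a b : a <= b ->
  (forall x, a <= x <= b -> is_derive x 1 f (df x)) ->
  (forall x, a <= x <= b -> 0 <= df x) -> f a <= f b.
Proof.
rewrite le_eqVlt => /predU1P[->//|ab] fdf df0.
have [c /andP[ac cb] fE] := mvt ab fdf.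
rewrite -subr_ge0 fE; apply: mulr_ge0; last by rewrite subr_ge0 ltW.
by apply: df0; rewrite !ltW.
Qed.

Lemma derive_lipschitz f df a b M :
  (forall x, a < x < b -> is_derive x 1 f (df x)) ->
  (forall x, a < x < b -> `|df x| <= M) ->
  forall x y, a < x < b -> a < y < b -> `|f x - f y| <= M * `|x - y|.
Proof.
move=> fdf dfM x y; wlog xy : x y / y <= x => [H xab yab|].
  have [|/ltW xy] := leP y x; first by move=> xy; exact: H.
  by rewrite distrC (distrC x); exact: H.
move=> /andP[ax xb] /andP[ay yb]; move: xy; rewrite le_eqVlt => /predU1P[->|yx].
  by rewrite !subrr normr0 mulr0.
have [|c /andP[yc cx] ->] := @mvt f df y x yx.
  by move=> z /andP[yz zx]; apply: fdf; rewrite (lt_le_trans ay)//=; exact: le_lt_trans xb.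
by rewrite normrM ler_wpM2r// dfM// (lt_trans ay)//=; exact: lt_trans xb.
Qed.

(** The integral from [- n] is a primitive only for [|s| < n]. The functions [G n], normalised to
    vanish at 0, agree where they overlap because their derivatives do, so they glue to a primitive
    on the whole line. *)
Lemma continuous_primitive h : continuous h ->
  exists H : R -> R, H 0 = 0 /\ forall s, is_derive s 1 H (h s).
Proof.
move=> ch.
pose G (n : nat) (s : R) := \int[lebesgue_measure]_(t in `[- n%:R, s]) h t.
have GE n s : `|s| < n%:R -> is_derive s 1 (G n) (h s).
  rewrite ltr_norml => /andP[ns sn].
  have [||dG GE] := @continuous_FTC1_closed R h (- n%:R) s n%:R sn _ ns.
  - apply: continuous_compact_integrable; first exact: segment_compact.
    exact: continuous_subspaceT.
  - exact: ch.
  - by apply: DeriveDef => //; rewrite -derive1E.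
have Gcst n m s : `|s| < n%:R -> (n <= m)%N -> G n s - G n 0 = G m s - G m 0.
  move=> sn nm.
  have n0 : 0 < n%:R :> R by apply: le_lt_trans sn.
  have nm' : n%:R <= m%:R :> R by rewrite ler_nat.
  have D x : - n%:R < x < n%:R -> is_derive x 1 (fun x => G n x - G m x) 0.
    rewrite -ltr_norml => xn; have ? := GE _ _ xn.
    have ? := GE _ _ (lt_le_trans xn nm').
    by apply: is_derive_eq; rewrite subrr.
  have Z (x : R) : - n%:R < x < n%:R -> `|(fun=> 0 : R) x| <= 0 by rewrite normr0.
  have /(_ s 0) := derive_lipschitz D Z.
  rewrite -ltr_norml sn n0 oppr_lt0 n0 mul0r => /(_ isT isT).
  by rewrite normr_le0 => /eqP; lra.
have bd s : `|s| < (Num.bound `|s|).+1%:R.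
  by rewrite (lt_trans (archi_boundP (normr_ge0 s)))// ltr_nat.
(* The index varies with [s]; to differentiate at [s] it is frozen to a constant [n], which changes
   nothing near [s] by [Gcst]. *)
exists (fun s => G (Num.bound `|s|).+1 s - G (Num.bound `|s|).+1 0); split.
  by rewrite subrr.
move=> s; set n := (Num.bound `|s|).+1.
apply: (@near_eq_is_derive _ _ _ (fun s => G n s - G n 0)); last first.
  rewrite -[X in is_derive _ _ _ X]subr0.
  by apply: is_deriveB; exact: GE.
have : \forall r \near s, `|r| < n%:R.
  have : `|r| @[r --> s] --> `|s| by exact: cvg_norm.
  move/cvgr_lt; apply; exact: bd.
apply: filterS => r rn.
have [le|/ltnW le] := leqP n (Num.bound `|r|).+1.
  exact: Gcst.
by apply/esym/Gcst.
Qed.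

Lemma is_derive_reflect f d x :
  is_derive (- x) 1 f d -> is_derive x 1 (fun s => f (- s)) (- d).
Proof.
move=> fd; have -> : (fun s => f (- s)) = f \o -%R by [].
by rewrite -mulrN1; apply: is_derive1_comp.
Qed.

(** Integrating an exponential weight gains the factor [1 / lam]; this is the source of the
    contraction in the Picard iteration. The upper bound for [s >= 0] is proved first and applied to
    the four functions [f (s)], [f (- s)] and their negatives. *)
Lemma expR_bound_of_derive f df M lam : 0 < lam -> 0 <= M ->
  f 0 = 0 -> (forall s, is_derive s 1 f (df s)) ->
  (forall s, `|df s| <= M * expR (lam * `|s|)) ->
  forall s, `|f s| <= M / lam * expR (lam * `|s|).
Proof.
move=> lam0 M0.
suff H f' df' s : 0 <= s -> f' 0 = 0 -> (forall s, is_derive s 1 f' (df' s)) ->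
    (forall s, `|df' s| <= M * expR (lam * `|s|)) ->
    f' s <= M / lam * expR (lam * `|s|).
  move=> f0 fdf dfM s; rewrite ler_norml lerNl; apply/andP; split.
    have [s0|/ltW s0] := leP 0 s.
      apply: (H (\- f) (\- df)) => //= [|r]; first by rewrite f0 oppr0.
      by rewrite normrN.
    rewrite -(normrN s) -[X in - f X](opprK s).
    apply: (H (fun s => - f (- s)) (fun s => df (- s))) => //=.
    - by rewrite oppr_ge0.
    - by rewrite oppr0 f0 oppr0.
    - move=> r; rewrite -(opprK (df _)); apply: is_deriveN.
      exact: is_derive_reflect.
    - by move=> r; rewrite (le_trans (dfM _))// normrN.
  have [s0|/ltW s0] := leP 0 s; first exact: (H f df).
  rewrite -(normrN s) -[X in f X](opprK s).
  apply: (H (fun s => f (- s)) (fun s => - df (- s))) => //=.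
  - by rewrite oppr_ge0.
  - by rewrite oppr0 f0.
  - by move=> r; exact: is_derive_reflect.
  - by move=> r; rewrite normrN (le_trans (dfM _))// normrN.
move=> s0 f0 fdf dfM.
pose g s := M / lam * expR (lam * s) - f' s.
have Dg x : is_derive x 1 g (M * expR (lam * x) - df' x).
  have ? := fdf x.
  apply: is_derive_eq.
  by rewrite /GRing.scale/=; field; rewrite gt_eqF.
have := @derive_ge0_le g _ 0 s s0 (fun x _ => Dg x).
rewrite /g f0 mulr0 expR0 subr0 mulr1 => H.
have : M / lam <= M / lam * expR (lam * s) - f' s.
  apply: H => x /andP[x0 _]; rewrite subr_ge0 (le_trans (ler_norm _))//.
  by rewrite (le_trans (dfM _))// ger0_norm.
rewrite ger0_norm// => {}H.
have : 0 <= M / lam by rewrite divr_ge0// ltW.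
lra.
Qed.

Lemma exists_expn2 x : exists k, x < 2 ^+ k.
Proof.
exists (Num.bound `|x|); apply: (le_lt_trans (ler_norm _)).
apply: (lt_le_trans (archi_boundP (normr_ge0 x))).
by rewrite -natrX ler_nat ltnW// ltn_expl.
Qed.

(** Serves as the passage to the limit: an estimate that holds for the iterates up to [C / 2 ^+ k]
    holds exactly for their limit. *)
Lemma geometric_le0 x C : (forall k, x <= C / 2 ^+ k) -> x <= 0.
Proof.
move=> xC; rewrite leNgt; apply/negP => x0.
have [k] := exists_expn2 (C / x); rewrite ltr_pdivrMr// => H.
by have := xC k; rewrite ler_pdivlMr ?exprn_gt0// mulrC leNgt H.
Qed.

(** The intervals of centre [u k] and radius [e k = 2 * C / 2 ^+ k] are nested, since
    [e k = C / 2 ^+ k + e k.+1]; the infimum of their right ends lies in all of them. *)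
Lemma geometric_cauchy_limit (u : nat -> R) C : 0 <= C ->
  (forall k, `|u k.+1 - u k| <= C / 2 ^+ k) ->
  exists l, forall k, `|u k - l| <= 2 * C / 2 ^+ k.
Proof.
move=> C0 uC; pose e k := 2 * C / 2 ^+ k : R.
have eS k : e k = C / 2 ^+ k + e k.+1.
  by rewrite /e exprS; field; rewrite expf_neq0.
have e0 k : 0 <= e k by rewrite /e divr_ge0// ?exprn_ge0// mulr_ge0.
have dec k m : u (k + m)%N + e (k + m)%N <= u k + e k.
  elim: m => [|m IH]; first by rewrite addn0.
  rewrite addnS; apply: le_trans IH.
  have := uC (k + m)%N; have := eS (k + m)%N; rewrite ler_norml => -> /andP[_].
  by lra.
have inc k m : u k - e k <= u (k + m)%N - e (k + m)%N.
  elim: m => [|m IH]; first by rewrite addn0.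
  rewrite addnS; apply: le_trans IH _.
  have := uC (k + m)%N; have := eS (k + m)%N; rewrite ler_norml => -> /andP[+ _].
  by lra.
have cross k m : u k - e k <= u m + e m.
  have := inc k m; have := dec m k; have := e0 (k + m)%N; rewrite (addnC m); lra.
pose A := range (fun k => u k + e k).
exists (inf A) => k; rewrite ler_norml; apply/andP; split.
  have : inf A <= u k + e k.
    apply: ge_inf; last by exists k.
    by exists (u 0%N - e 0%N) => _ [m _ <-]; exact: cross.
  by rewrite /e; lra.
have : u k - e k <= inf A.
  apply: lb_le_inf; first by exists (u 0%N + e 0%N), 0%N.
  by move=> _ [m _ <-]; exact: cross.
by rewrite /e; lra.
Qed.

Lemma lipschitz_continuous f M :
  (forall x y, `|f x - f y| <= M * `|x - y|) -> continuous f.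
Proof.
move=> fM x; apply/cvgrPdist_lt => e e0.
have M0 : 0 < `|M| + 1 by rewrite ltr_wpDl.
near=> y.
apply: (le_lt_trans (fM _ _)).
apply: (@le_lt_trans _ _ ((`|M| + 1) * `|x - y|)).
  by rewrite ler_wpM2r// (le_trans (ler_norm _))// lerDl.
rewrite -ltr_pdivlMl//; near: y.
apply: cvgr_dist_lt => //; by rewrite mulr_gt0// invr_gt0.
Unshelve. all: by end_near. Qed.

(** Inverts the change between the times t and tau. The uniform lower bound [c] of the derivative
    makes [f] onto, so that the inverse is defined on the whole line. *)
Lemma derive_gt0_inverse (f df : R -> R) (c : R) : 0 < c ->
  (forall s : R, is_derive s 1 f (df s)) -> (forall s, c <= df s) ->
  exists g : R -> R, [/\ cancel g f, cancel f g,
    forall s t, (g s < g t) = (s < t) &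
    forall t : R, is_derive t 1 g (df (g t))^-1].
Proof.
move=> c0 fD cdf.
have growth s t : s < t -> c * (t - s) <= f t - f s.
  move=> st; have [x _ ->] := mvt st (fun x _ => fD x).
  by rewrite ler_wpM2r// subr_ge0 ltW.
have fmono : {mono f : s t / s < t}.
  have H s t : s < t -> f s < f t.
    move=> st; rewrite -subr_gt0; apply: lt_le_trans (growth s t st).
    by rewrite mulr_gt0// subr_gt0.
  move=> s t; apply/idP/idP => [|/H//]; apply: contraTT; rewrite -!leNgt le_eqVlt.
  by move=> /predU1P[->//|/H/ltW].
have cf : continuous f by move=> s; exact: is_derive_continuous (fD s).
have surj t : exists s, f s = t.
  (* With this [N], growth at rate [c] moves [f] away from [f 0] by more than [|t - f 0|] on both
     sides, so [t] is an intermediate value. *)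
  pose N := `|t - f 0| / c + 1.
  have N0 : 0 < N by rewrite ltr_wpDl// divr_ge0// ltW.
  have cN : c * N = `|t - f 0| + c by rewrite /N; field; rewrite gt_eqF.
  have hi := growth 0 N N0; rewrite subr0 cN in hi.
  have lo := growth (- N) 0; rewrite oppr_lt0 opprK add0r cN in lo.
  have {}lo := lo N0.
  have := ler_norm (t - f 0); have := ler_norm (f 0 - t); rewrite distrC => n1 n2.
  have [|||s _ <-] := @IVT R f (- N) N t; last by exists s.
  - lra.
  - exact: continuous_subspaceT.
  - by rewrite ge_min le_max; apply/andP; split; apply/orP; [left|right]; lra.
have /choice[g gP] := surj.
have fK : cancel f g.
  move=> s; have E := gP (f s).
  by case: (ltgtP (g (f s)) s) => //; rewrite -fmono E ltxx.
exists g; split => // [s t|t]; first by rewrite -fmono !gP.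
rewrite -{1}(gP t); apply: is_derive_inverse => //.
- by apply: filterE => x; exact: fK.
- by apply: filterE => x; exact: cf.
- by rewrite gt_eqF// (lt_le_trans c0).
Qed.

End calculus.

Section picard.
Context {R : realType} {I : Type}.

(* In the norm sup |f s| / exp (2 M |s|) the Picard iteration contracts by 1/2 on
   the whole line, so no continuation argument is needed. *)
Lemma picard_global (F : (I -> R) -> I -> R) (B L : R) (a : I -> R) :
  (forall (z : I -> R) (i : I), `|F z i| <= B) ->
  (forall (z w : I -> R) (i : I) (r : R), (forall j, `|z j - w j| <= r) ->
    `|F z i - F w i| <= L * r) ->
  exists z : I -> R -> R, (forall i, z i 0 = a i) /\
    forall (i : I) (s : R), is_derive s 1 (z i) (F (z ^~ s) i).
Proof.
move=> FB FL0.
have [[i0]|noI] := pselect (exists i : I, True); last first.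
  by exists (fun i _ => a i); split => // i; case: noI; exists i.
have B0 : 0 <= B by rewrite (le_trans _ (FB a i0)).
pose M : R := `|L| + 1.
have M0 : 0 < M by rewrite ltr_wpDl.
have FM (z w : I -> R) (i : I) (r : R) :
    (forall j, `|z j - w j| <= r) -> `|F z i - F w i| <= M * r.
  move=> zw; apply: le_trans (FL0 _ _ _ _ zw) _; rewrite ler_wpM2r//.
    by rewrite (le_trans _ (zw i0)).
  by rewrite (le_trans (ler_norm _))// lerDl.
(* [prim] is total so that the iteration can be defined at once; it is a primitive only of
   continuous functions, and continuity of the integrands is checked afterwards. *)
have /choice[prim primP] : forall h : R -> R, exists H : R -> R,
    continuous h -> H 0 = 0 /\ forall s : R, is_derive s 1 H (h s).
  move=> h; have [/continuous_primitive[H HP]|nc] := pselect (continuous h).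
    by exists H.
  by exists h.
pose step (z : I -> R -> R) i s := a i + prim (fun r => F (z ^~ r) i) s.
have contF (z : I -> R -> R) :
    (forall (i : I) (x y : R), `|z i x - z i y| <= B * `|x - y|) ->
    forall i, continuous (fun r => F (z ^~ r) i).
  move=> zB i; apply: (@lipschitz_continuous _ _ (M * B)) => x y.
  by rewrite -mulrA; exact: FM.
have stepD (z : I -> R -> R) :
    (forall (i : I) (x y : R), `|z i x - z i y| <= B * `|x - y|) ->
    forall (i : I) (s : R), is_derive s 1 (step z i) (F (z ^~ s) i).
  move=> zB i s; have [_ /(_ s) ?] := primP _ (contF _ zB i).
  rewrite /step -[X in is_derive _ _ _ X]add0r.
  exact: (is_deriveD (f := cst (a i))).
have step0 (z : I -> R -> R) :
    (forall (i : I) (x y : R), `|z i x - z i y| <= B * `|x - y|) ->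
    forall i, step z i 0 = a i.
  by move=> zB i; have [p0 _] := primP _ (contF _ zB i); rewrite /step p0 addr0.
pose z := fix z k := if k is k'.+1 then step (z k') else (fun i _ => a i).
(* All iterates have the Lipschitz constant [B], uniformly in [k] and [i]; this gives the continuity
   of the integrands and survives in the limit. *)
have zB k i x y : `|z k i x - z k i y| <= B * `|x - y|.
  elim: k i x y => [|k IH] i x y /=; first by rewrite subrr normr0 mulr_ge0.
  pose m := `|x| + `|y| + 1.
  apply: (@derive_lipschitz _ (step (z k) i) (fun s => F (z k ^~ s) i) (- m) m) => //.
  - by move=> s _; exact: stepD.
  - by rewrite -ltr_norml ltr_pwDr// lerDl.
  - by rewrite -ltr_norml ltr_pwDr// lerDr.
pose lam := 2 * M.
have lam0 : 0 < lam by rewrite mulr_gt0.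
have zS k i s : `|z k.+1 i s - z k i s| <= B * expR (lam * `|s|) / 2 ^+ k.
  elim: k i s => [|k IH] i s.
    rewrite expr0 divr1.
    have := zB 1%N i s 0; rewrite subr0 /= (step0 (z 0%N))// => /le_trans; apply.
    rewrite ler_wpM2l//; apply: le_trans (expR_ge1Dx _).
    apply: (@le_trans _ _ (lam * `|s|)); last by rewrite lerDr.
    rewrite ler_peMl// /lam /M; have := normr_ge0 L; lra.
  have Df (r : R) : is_derive r 1 (fun s => step (z k.+1) i s - step (z k) i s)
      (F (z k.+1 ^~ r) i - F (z k ^~ r) i).
    have ? := stepD _ (zB k.+1) i r; have ? := stepD _ (zB k) i r.
    exact: is_deriveB.
  have -> : B * expR (lam * `|s|) / 2 ^+ k.+1 =
      (M * (B / 2 ^+ k)) / lam * expR (lam * `|s|).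
    rewrite /lam exprS; field; rewrite gt_eqF//=; apply: expf_neq0; exact: pnatr_eq0.
  apply: (expR_bound_of_derive lam0 _ _ Df).
  - by rewrite !mulr_ge0// ?invr_ge0 ?exprn_ge0// ltW.
  - by rewrite (step0 _ (zB k.+1)) (step0 _ (zB k)) subrr.
  - move=> r; rewrite -mulrA; apply: FM => j.
    by rewrite mulrAC; exact: IH.
have C0 (s : R) : 0 <= B * expR (lam * `|s|) by rewrite mulr_ge0// expR_ge0.
have [zi ziP] : exists zi : I -> R -> R, forall (i : I) (s : R) (k : nat),
    `|z k i s - zi i s| <= 2 * (B * expR (lam * `|s|)) / 2 ^+ k.
  have [zi ziP] := choice (fun p : I * R =>
    geometric_cauchy_limit (C0 p.2) (fun k => zS k p.1 p.2)).
  by exists (fun i s => zi (i, s)) => i s; exact: (ziP (i, s)).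
have ziB i x y : `|zi i x - zi i y| <= B * `|x - y|.
  rewrite -subr_le0; apply: (@geometric_le0 _ _
    (2 * (B * expR (lam * `|x|)) + 2 * (B * expR (lam * `|y|)))) => k.
  rewrite mulrDl lerBlDr.
  have -> : zi i x - zi i y = - (z k i x - zi i x) + (z k i y - zi i y) +
    (z k i x - z k i y) by lra.
  apply: (le_trans (ler_normD _ _)); apply: lerD => //.
  apply: (le_trans (ler_normD _ _)); rewrite normrN; exact: lerD.
have ziE i s : step zi i s = zi i s.
  apply/eqP; rewrite -subr_eq0 -normr_le0; apply: (@geometric_le0 _ _
    (2 * (B * expR (lam * `|s|)))) => k.
  have -> : step zi i s - zi i s =
    - (step (z k) i s - step zi i s) + (z k.+1 i s - zi i s) by rewrite /=; lra.
  apply: (le_trans (ler_normD _ _)); rewrite normrN.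
  have -> : 2 * (B * expR (lam * `|s|)) / 2 ^+ k =
    M * (2 * B / 2 ^+ k) / lam * expR (lam * `|s|) +
     2 * (B * expR (lam * `|s|)) / 2 ^+ k.+1.
    rewrite /lam exprS; field; by rewrite (gt_eqF M0) expf_neq0.
  apply: lerD => //.
  have Df (r : R) : is_derive r 1 (fun s => step (z k) i s - step zi i s)
      (F (z k ^~ r) i - F (zi ^~ r) i).
    have ? := stepD _ (zB k) i r; have ? := stepD _ ziB i r.
    exact: is_deriveB.
  apply: (expR_bound_of_derive lam0 _ _ Df).
  - by rewrite !mulr_ge0// ?invr_ge0 ?exprn_ge0// ltW.
  - by rewrite (step0 _ (zB k)) (step0 _ ziB) subrr.
  - move=> r; rewrite -[leRHS]mulrA; apply: FM => j.
    by rewrite mulrAC -(mulrA 2); exact: ziP.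
(* [step zi] is differentiable by construction, and the fixed point equation [ziE] lets its
   derivative be read as the field along [step zi] itself. *)
exists (step zi); split => i; first exact: step0.
move=> s; have -> : step zi ^~ s = zi ^~ s by apply/funext => j; exact: ziE.
exact: stepD.
Qed.

End picard.

(** * Area contraction *)

Section plane.
Context {R : realType}.
Local Notation leb := (@lebesgue_measure R).

(** An open set is the union of the rational boxes inside it. Boxes that leave [O] contribute the
    empty set to [F], so the union runs over a fixed countable type. *)
Lemma open_measurable_plane (O : set (R * R)) :
  open O -> measurable (O : set (measurableTypeR R * measurableTypeR R)).
Proof.
move=> oO.
pose B (q : rat * rat) : set R := ball (ratr q.1 : R) (ratr q.2).
pose F (q : (rat * rat) * (rat * rat)) : set (measurableTypeR R * measurableTypeR R) :=
  [set z | B q.1 `*` B q.2 `<=` O /\ (B q.1 `*` B q.2) z].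
have -> : O = \bigcup_q F q.
  apply/seteqP; split; last by move=> z [q _ [/(_ z)]].
  move=> [x y] Oxy.
  have /nbhs_ballP[e /= e0 eO] := open_nbhs_nbhs (conj oO Oxy).
  have [c [r [/set_mem/= xB BS]]] := open_subball_rat (ball_open x e) (mem_set (ballxx x e0)).
  have [c' [r' [/set_mem/= yB BS']]] := open_subball_rat (ball_open y e) (mem_set (ballxx y e0)).
  exists ((c, r), (c', r')) => //; split => //=.
  move=> [a b] [/= /BS ea /BS' eb]; apply: eO; exact: conj ea eb.
apply: countable_bigcupT_measurable => [|q]; first exact: countableP.
have [BO|BO] := pselect (B q.1 `*` B q.2 `<=` O).
  have -> : F q = B q.1 `*` B q.2 by apply/seteqP; split => [z []|z].
  by apply: measurableX; exact: measurable_ball.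
have -> : F q = set0 by apply/seteqP; split => [z []|z].
exact: measurable0.
Qed.

Lemma compact_measurable_plane (Q : set (R * R)) :
  compact Q -> measurable (Q : set (measurableTypeR R * measurableTypeR R)).
Proof.
move=> cQ; rewrite -(setCK Q); apply: measurableC.
apply: open_measurable_plane; apply: closed_openC.
apply: compact_closed => //; exact: norm_hausdorff.
Qed.

(** Argued on the outer measure, hence for arbitrary sets: if intervals cover the first projection,
    the part of [r] above an interval of length h has its second coordinates in an interval of
    length at most [L] h. *)
Lemma lebesgue_lipschitz_relation (r : set (R * R)) (L : R) : 0 < L ->
  (forall p q, r p -> r q -> `|p.2 - q.2| <= L * `|p.1 - q.1|) ->
  (leb (snd @` r) <= L%:E * leb (fst @` r))%E.
Proof.
move=> L0 rL.
rewrite -lee_pdivrMl//.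
apply: le_ereal_inf_tmp => _ [F [mF cF] <-].
rewrite lee_pdivrMl// -nneseriesZl//.
pose G k := snd @` (r `&` fst @^-1` F k).
have : snd @` r `<=` \bigcup_k G k.
  move=> _ [p rp <-]; have [k _ Fk] := cF p.1 (ex_intro2 _ _ p rp erefl).
  by exists k => //; exists p.
move=> /(le_outer_measure ((wlength idfun)^*)%mu) rG.
apply: (le_trans rG).
apply: le_trans (outer_measure_sigma_subadditive _ _) _.
apply: lee_nneseries => [k _ _|k _]; first exact: outer_measure_ge0.
have /ocitvP[F0|[[a b] /= ab FE]] := mF k.
  have -> : G k = set0.
    by apply/seteqP; split => // x [p [_ Fp] _]; move: Fp; rewrite /= F0.
  rewrite outer_measure0; apply: mule_ge0; first by rewrite lee_fin ltW.
  exact: measure_ge0.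
rewrite FE wlength_itv_bnd ?(ltW ab)//.
have [G0|/nonemptyPn ->] := pselect (G k !=set0); last first.
  by rewrite outer_measure0 mule_ge0// lee_fin// ?subr_ge0 ltW.
have diff x y : G k x -> G k y -> x - y <= L * (b - a).
  move=> [p [rp Fp] <-] [q [rq Fq] <-].
  apply: (le_trans (ler_norm _)); apply: le_trans (rL _ _ rp rq) _.
  move: Fp Fq; rewrite /= FE /= !in_itv/= => /andP[ap pb] /andP[aq qb].
  by rewrite ler_pM2l// ler_norml; lra.
have [g0 Gg0] := G0.
have hi : has_sup (G k).
  split => //; exists (g0 + L * (b - a)) => x Gx.
  by have := diff _ _ Gx Gg0; lra.
have lo : has_inf (G k).
  split => //; exists (g0 - L * (b - a)) => x Gx.
  by have := diff _ _ Gg0 Gx; lra.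
have Gsub : G k `<=` `[inf (G k), sup (G k)].
  move=> x Gx /=; rewrite in_itv/=; apply/andP; split.
    by apply: ge_inf => //; case: lo.
  by apply: ub_le_sup => //; case: hi.
apply: le_trans (le_outer_measure ((wlength idfun)^*)%mu _ _ Gsub) _.
have iles : inf (G k) <= sup (G k).
  by apply: (@le_trans _ _ g0); [apply: ge_inf|apply: ub_le_sup] => //; [case: lo|case: hi].
apply: (@le_trans _ _ (leb `[inf (G k), sup (G k)])); first by [].
rewrite lebesgue_measure_itv/= lte_fin.
have main : sup (G k) - inf (G k) <= L * (b - a).
  rewrite lerBlDr; apply: ge_sup => // x Gx; rewrite -lerBlDl.
  apply: lb_le_inf => // y Gy; have := diff _ _ Gx Gy; lra.
case: ifP => _; first by rewrite -EFinB -EFinM lee_fin.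
by rewrite -EFinM lee_fin mulr_ge0// ?subr_ge0 ltW.
Qed.

Local Notation leb2 := (leb \x leb)%E.

Lemma leb2_le_xsection (A B : set (R * R)) (L : R) :
  measurable (A : set (measurableTypeR R * measurableTypeR R)) ->
  measurable (B : set (measurableTypeR R * measurableTypeR R)) -> 0 <= L ->
  (forall x, (leb (xsection A x) <= L%:E * leb (xsection B x))%E) ->
  (leb2 A <= L%:E * leb2 B)%E.
Proof.
move=> mA mB L0 AB; rewrite /product_measure1 -ge0_integralZl//=; last first.
  exact: measurable_fun_xsection.
apply: ge0_le_integral => //=.
- exact: measurable_fun_xsection.
- apply: measurable_funeM; exact: measurable_fun_xsection.
Qed.

(** The product measure integrates x-sections; by uniqueness of the product measure it also
    integrates y-sections. *)
Lemma leb2_le_ysection (A B : set (R * R)) (L : R) :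
  measurable (A : set (measurableTypeR R * measurableTypeR R)) ->
  measurable (B : set (measurableTypeR R * measurableTypeR R)) -> 0 <= L ->
  (forall y, (leb (ysection A y) <= L%:E * leb (ysection B y))%E) ->
  (leb2 A <= L%:E * leb2 B)%E.
Proof.
move=> mA mB L0 AB.
have E X : measurable X -> leb2 X = (leb \x^ leb)%E X.
  by apply: product_measure_unique => ? ? ? ?; exact: product_measure2E.
rewrite !E// /product_measure2 -ge0_integralZl//=; last first.
  exact: measurable_fun_ysection.
apply: ge0_le_integral => //=.
- exact: measurable_fun_ysection.
- apply: measurable_funeM; exact: measurable_fun_ysection.
Qed.

(* E is the graph of a planar map ((phi, u), (Phi, U)), compared through the
   intermediate points (phi, U). *)
Lemma leb2_image_contraction (E : set ((R * R) * (R * R))) (L1 L2 C N : R) :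
  compact E -> 0 < L1 -> 0 < L2 -> L1 * L2 < 1 ->
  (forall e, E e -> `|e.2.1| <= N /\ `|e.2.2| <= N) ->
  (forall e f, E e -> E f ->
    `|e.2.2 - f.2.2| <= L1 * `|e.1.2 - f.1.2| + C * `|e.1.1 - f.1.1|) ->
  (forall e f, E e -> E f ->
    `|e.2.1 - f.2.1| <= L2 * `|e.1.1 - f.1.1| + C * `|e.2.2 - f.2.2|) ->
  fst @` E `<=` snd @` E -> leb2 (snd @` E) = 0%E.
Proof.
move=> cE L10 L20 L12 EN E1 E2 E12.
pose M := (fun e : (R * R) * (R * R) => (e.1.1, e.2.2)) @` E.
have cimg (f : (R * R) * (R * R) -> R * R) : continuous f -> compact (f @` E).
  by move=> cf; apply: continuous_compact => //; exact: continuous_subspaceT.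
have mQ : measurable (snd @` E : set (measurableTypeR R * measurableTypeR R)).
  by apply: compact_measurable_plane; apply: cimg => e; exact: cvg_snd.
have mQ' : measurable (fst @` E : set (measurableTypeR R * measurableTypeR R)).
  by apply: compact_measurable_plane; apply: cimg => e; exact: cvg_fst.
have c11 : continuous (fun e : (R * R) * (R * R) => e.1.1).
  by move=> e; apply: (@continuous_comp _ _ _ fst fst); exact: cvg_fst.
have c22 : continuous (fun e : (R * R) * (R * R) => e.2.2).
  by move=> e; apply: (@continuous_comp _ _ _ snd snd); exact: cvg_snd.
have mM : measurable (M : set (measurableTypeR R * measurableTypeR R)).
  apply: compact_measurable_plane; apply: cimg => e.
  exact: (cvg_pair (c11 e) (c22 e)).
(* On a vertical line phi is fixed, so the term in [C] of the first estimate vanishes and u -> U is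
   Lipschitz with constant [L1]. *)
have MQ' : (leb2 M <= L1%:E * leb2 (fst @` E))%E.
  apply: leb2_le_xsection => //; first exact: ltW.
  move=> x; pose r := (fun e : (R * R) * (R * R) => (e.1.2, e.2.2)) @`
    (E `&` [set e | e.1.1 = x]).
  have -> : xsection M x = snd @` r.
    apply/seteqP; split => [y /set_mem/= [e Ee [ex ey]]|y].
      by exists (e.1.2, e.2.2) => //; exists e.
    move=> [_ [e [Ee /= ex] <-] /= ey]; apply/mem_set; exists e => //.
    by rewrite ex ey.
  have <- : fst @` r = xsection (fst @` E) x.
    apply/seteqP; split => y.
      move=> [_ [e [Ee /= ex] <-] /= ey]; apply/mem_set; exists e => //.
      by rewrite -ex -ey -surjective_pairing.
    move=> /set_mem/= [e Ee exy].
    exists (e.1.2, e.2.2); last by rewrite /= exy.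
    by exists e => //; split => //=; rewrite exy.
  apply: lebesgue_lipschitz_relation => // _ _ [e [Ee ex] <-] [f [Ef fx] <-] /=.
  apply: le_trans (E1 _ _ Ee Ef) _.
  by rewrite /= in ex fx; rewrite ex fx subrr normr0 mulr0 addr0.
(* On a horizontal line U is fixed, so the second estimate makes phi -> Phi Lipschitz with constant
   [L2]. *)
have QM : (leb2 (snd @` E) <= L2%:E * leb2 M)%E.
  apply: leb2_le_ysection => //; first exact: ltW.
  move=> y; pose r := (fun e : (R * R) * (R * R) => (e.1.1, e.2.1)) @`
    (E `&` [set e | e.2.2 = y]).
  have -> : ysection (snd @` E) y = snd @` r.
    apply/seteqP; split => x.
      move=> /set_mem/= [e Ee exy].
      exists (e.1.1, e.2.1); last by rewrite /= exy.
      by exists e => //; split => //=; rewrite exy.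
    move=> [_ [e [Ee /= ey] <-] /= ex]; apply/mem_set; exists e => //.
    by rewrite -ex -ey -surjective_pairing.
  have <- : fst @` r = ysection M y.
    apply/seteqP; split => x.
      move=> [_ [e [Ee /= ey] <-] /= ex]; apply/mem_set; exists e => //.
      by rewrite ex ey.
    move=> /set_mem/= [e Ee [ex ey]].
    by exists (e.1.1, e.2.1) => //; exists e.
  apply: lebesgue_lipschitz_relation => // _ _ [e [Ee ex] <-] [f [Ef fx] <-] /=.
  apply: le_trans (E2 _ _ Ee Ef) _.
  by rewrite /= in ex fx; rewrite ex fx subrr normr0 mulr0 addr0.
have bN : (leb [set` `[(- N)%R, N]] < +oo)%E.
  by rewrite lebesgue_measure_itv/= lte_fin; case: ifP => _; rewrite ?ltry// -EFinB ltry.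
have fin : (leb2 (snd @` E) < +oo)%E.
  apply: (@le_lt_trans _ _ (leb2 (`[- N, N] `*` `[- N, N])%classic)).
    apply: (le_measure (leb \x leb)%E); [exact: (mem_set mQ)| |].
      by apply/mem_set; apply: measurableX; exact: measurable_itv.
    move=> _ [e Ee <-]; have [] := EN e Ee.
    by rewrite !ler_norml => n1 n2; split; rewrite /= in_itv/=.
  rewrite product_measure1E//; try exact: measurable_itv.
  by apply: lte_mul_pinfty; rewrite ?ge0_fin_numE.
have Qfin : leb2 (snd @` E) \is a fin_num by rewrite ge0_fin_numE// measure_ge0.
(* The inclusion [fst @] E [<=] snd @[E] closes the loop: a finite measure bounded by [L2 * L1 < 1]
   times itself is zero. *)
have : (leb2 (snd @` E) <= (L2 * L1)%:E * leb2 (snd @` E))%E.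
  apply: (le_trans QM); rewrite EFinM -muleA lee_pmul2l//.
  apply: (le_trans MQ'); rewrite lee_pmul2l//.
  by apply: (le_measure (leb \x leb)%E) => //; [exact: (mem_set mQ')|exact: (mem_set mQ)].
move: Qfin; case E0 : (leb2 _) => [q| |] // _.
have q0 : 0 <= q by rewrite -lee_fin -E0 measure_ge0.
rewrite -EFinM lee_fin => qL; congr (_%:E); apply/eqP; rewrite eq_le q0 andbT.
rewrite -(pmulr_rle0 q (_ : 0 < 1 - L2 * L1)); first lra.
by rewrite subr_gt0 mulrC.
Qed.

Lemma closure_pairwise (T : topologicalType) (A : set T) (g : T -> T -> R) :
  (forall y, continuous (g ^~ y)) -> (forall x, continuous (g x)) ->
  (forall x y, A x -> A y -> g x y <= 0) ->
  forall x y, closure A x -> closure A y -> g x y <= 0.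
Proof.
move=> c1 c2 gA x y Ax Ay.
have cl (f : T -> R) : continuous f -> closed [set z | f z <= 0].
  move=> cf; rewrite -[[set z | f z <= 0]]/(f @^-1` [set z | z <= 0]).
  by apply: preimage_closed => [z _|]; [exact: cf|exact: closed_le].
have step z : A z -> g x z <= 0.
  move=> Az; have := closureS (fun u (Au : A u) => gA u z Au Az).
  by move/(_ x Ax); rewrite -(closure_id _).1//; exact: cl (c1 z).
have := closureS (fun z (Az : A z) => step z Az : [set u | g x u <= 0] z).
by move/(_ y Ay); rewrite -(closure_id _).1//; exact: cl (c2 x).
Qed.

(** No measurability of [P] is assumed. Its closure is compact and inherits the non-strict estimates
    by continuity, so the compact case applies to it. *)
Lemma negligible_contraction (P : set ((R * R) * (R * R))) (L1 L2 C N : R) :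
  0 < L1 -> 0 < L2 -> L1 * L2 < 1 ->
  (forall e, P e -> [/\ `|e.1.1| <= N, `|e.1.2| <= N, `|e.2.1| <= N & `|e.2.2| <= N]) ->
  (forall e f, P e -> P f ->
    `|e.2.2 - f.2.2| <= L1 * `|e.1.2 - f.1.2| + C * `|e.1.1 - f.1.1|) ->
  (forall e f, P e -> P f ->
    `|e.2.1 - f.2.1| <= L2 * `|e.1.1 - f.1.1| + C * `|e.2.2 - f.2.2|) ->
  fst @` P `<=` snd @` P -> leb2.-negligible (snd @` P).
Proof.
move=> L10 L20 L12 PN P1 P2 P12; pose E := closure P.
pose I : set R := [set` `[- N, N]]; pose box := (I `*` I) `*` (I `*` I).
have cbox : compact box.
  by apply: compact_setX; apply: compact_setX; exact: segment_compact.
have Ebox : E `<=` box.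
  have /closure_id -> : closed box by apply: compact_closed => //; exact: norm_hausdorff.
  apply: closureS => e /PN[]; rewrite !ler_norml => ? ? ? ?.
  by split; split; rewrite /I/= in_itv.
have cE : compact E.
  by apply: (subclosed_compact _ cbox) => //; exact: closed_closure.
have c11 : continuous (fun e : (R * R) * (R * R) => e.1.1).
  by move=> e; apply: (@continuous_comp _ _ _ fst fst); exact: cvg_fst.
have c12 : continuous (fun e : (R * R) * (R * R) => e.1.2).
  by move=> e; apply: (@continuous_comp _ _ _ fst snd); [exact: cvg_fst|exact: cvg_snd].
have c21 : continuous (fun e : (R * R) * (R * R) => e.2.1).
  by move=> e; apply: (@continuous_comp _ _ _ snd fst); [exact: cvg_snd|exact: cvg_fst].
have c22 : continuous (fun e : (R * R) * (R * R) => e.2.2).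
  by move=> e; apply: (@continuous_comp _ _ _ snd snd); exact: cvg_snd.
have est (a b c : (R * R) * (R * R) -> R) L : continuous a -> continuous b -> continuous c ->
    (forall e f, P e -> P f -> `|a e - a f| <= L * `|b e - b f| + C * `|c e - c f|) ->
    forall e f, E e -> E f -> `|a e - a f| <= L * `|b e - b f| + C * `|c e - c f|.
  move=> ca cb cc abc e f Ee Ef; rewrite -subr_le0.
  pose g e f := `|a e - a f| - (L * `|b e - b f| + C * `|c e - c f|).
  apply: (@closure_pairwise _ P g) => //.
  - move=> y x; apply: cvgB; last apply: cvgD.
    + by apply: cvg_norm; apply: cvgB; [exact: ca|exact: cvg_cst].
    + by apply: cvgMr; apply: cvg_norm; apply: cvgB; [exact: cb|exact: cvg_cst].
    + by apply: cvgMr; apply: cvg_norm; apply: cvgB; [exact: cc|exact: cvg_cst].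
  - move=> y x; apply: cvgB; last apply: cvgD.
    + by apply: cvg_norm; apply: cvgB; [exact: cvg_cst|exact: ca].
    + by apply: cvgMr; apply: cvg_norm; apply: cvgB; [exact: cvg_cst|exact: cb].
    + by apply: cvgMr; apply: cvg_norm; apply: cvgB; [exact: cvg_cst|exact: cc].
  - by move=> x y Px Py; rewrite subr_le0; exact: abc.
have csE : compact (snd @` E).
  apply: continuous_compact => //; apply: continuous_subspaceT => e; exact: cvg_snd.
have E0 : leb2 (snd @` E) = 0%E.
  apply: (@leb2_image_contraction E L1 L2 C N) => //.
  - by move=> e /Ebox[_ []]; rewrite /I/= !in_itv/= !ler_norml.
  - exact: est.
  - exact: est.
  - have clE : closed ((fst : (R * R) * (R * R) -> R * R) @^-1` (snd @` E)).
      have H := @preimage_closed _ _ (fst : (R * R) * (R * R) -> R * R) (snd @` E).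
      apply: H => [e _|]; first exact: cvg_fst.
      by apply: compact_closed => //; exact: norm_hausdorff.
    have : E `<=` fst @^-1` (snd @` E).
      rewrite [X in _ `<=` X]((closure_id _).1 clE).
      apply: closureS => e Pe /=.
      have [f Pf <-] := P12 _ (ex_intro2 _ _ e Pe erefl).
      by exists f => //; exact: subset_closure.
    by move=> H _ [e Ee <-]; exact: H.
exists (snd @` E); split => //.
- by apply: compact_measurable_plane.
- by move=> _ [e Pe <-]; exists e => //; exact: subset_closure.
Qed.
End plane.

(** * Comparison of two trajectories *)

Section estimates.
Context {R : realType}.
Implicit Types (f df d e A B : R -> R) (a b c s t x T C N M : R).

Lemma norm_max_segment f a b : a <= b ->
  (forall x, a <= x <= b -> {for x, continuous f}) ->
  exists M, (forall x, a <= x <= b -> `|f x| <= M) /\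
    exists2 c, a <= c <= b & `|f c| = M.
Proof.
move=> ab cf.
have [|c cab fc] := @EVT_max R (fun x => `|f x|) a b ab.
  apply: continuous_in_subspaceT => x; rewrite inE/= in_itv/= => axb.
  apply: cvg_norm; exact: cf.
exists `|f c|; split; first by move=> x axb; apply: fc; rewrite in_itv.
by exists c => //; move: cab; rewrite in_itv.
Qed.

Lemma continuous_derive_lipschitz f df N :
  (forall x, is_derive x 1 f (df x)) -> continuous df ->
  exists2 M, 0 <= M & (forall x, `|x| <= N -> `|f x| <= M) /\
    forall x y, `|x| <= N -> `|y| <= N -> `|f x - f y| <= M * `|x - y|.
Proof.
move=> fdf cdf.
have [N0|N0] := ltP N 0.
  by exists 0 => //; split=> x; rewrite leNgt (lt_le_trans N0).
(* The margin 1 puts the endpoints [N] and [- N] inside the open interval on which the derivative is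
   bounded. *)
have NN : - (N + 1) <= N + 1 by lra.
have [M1 [fM1 [c1 _ M1E]]] := norm_max_segment NN (fun x _ => is_derive_continuous (fdf x)).
have [M2 [fM2 [c2 _ M2E]]] := norm_max_segment NN (fun x _ => cdf x).
have M10 : 0 <= M1 by rewrite -M1E.
have M20 : 0 <= M2 by rewrite -M2E.
exists (M1 + M2); first exact: addr_ge0.
split=> [x|x y]; first by rewrite ler_norml => xN; rewrite ler_wpDr// fM1//; lra.
move=> xN yN; rewrite mulrDl ler_wpDl ?mulr_ge0//.
move: xN yN; rewrite (ler_norml x) (ler_norml y) => xN yN.
have dfM z : - (N + 1) < z < N + 1 -> `|df z| <= M2.
  by move=> /andP[z1 z2]; apply: fM2; rewrite !ltW.
by apply: (derive_lipschitz (fun z _ => fdf z) dfM); lra.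
Qed.

(* The equation of the differences d = phi1 - phi2 and e = u1 - u2 of two
   trajectories. *)
Definition linear_segment d e A B T c C := forall t, - T <= t <= 0 ->
  [/\ is_derive t 1 d (e t), is_derive t 1 e (- A t * e t + B t),
      c <= A t <= C & `|B t| <= C * `|d t|].

Lemma segment_growth T f df s t M : 0 < T ->
  (forall t, - T <= t <= 0 -> is_derive t 1 f (df t)) ->
  (forall t, - T <= t <= 0 -> `|df t| <= M) -> 0 <= M ->
  - T <= s <= 0 -> - T <= t <= 0 -> `|f t - f s| <= T * M.
Proof.
move=> T0 fdf dfM M0; wlog st : s t / s <= t => [H sT tT|sT tT].
  have [st|/ltW st] := leP s t; first exact: H.
  by rewrite distrC; exact: H.
move: st; rewrite le_eqVlt => /predU1P[->|st].
  by rewrite subrr normr0 mulr_ge0// ltW.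
have [|x xst ->] := @mvt _ f df s t st.
  by move=> x xst; apply: fdf; lra.
rewrite normrM mulrC; apply: ler_pM => //; last by apply: dfM; lra.
by rewrite ler_norml; lra.
Qed.

(** [E] and [D] are the maxima of [|e|] and [|d|] on the segment. Comparing them with the values at
    one time [s] gives two implicit inequalities, which are solvable for small [T * C] and take the
    place of a Gronwall estimate. *)
Lemma linear_segment_bounds d e A B T c C :
  0 < T -> 1 <= C -> 0 <= c -> linear_segment d e A B T c C ->
  exists E D, [/\ 0 <= E, 0 <= D,
  (forall t, - T <= t <= 0 -> `|e t| <= E /\ `|d t| <= D) &
  forall s, - T <= s <= 0 ->
   [/\ (forall t, - T <= t <= 0 -> `|e t - e s| <= T * C * (E + D)),
       (forall t, - T <= t <= 0 -> `|d t - d s| <= T * E),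
       E <= `|e s| + T * C * (E + D) & D <= `|d s| + T * E]].
Proof.
move=> T0 C1 c0 lin.
have dD t : - T <= t <= 0 -> is_derive t 1 d (e t) by case/lin.
have eD t : - T <= t <= 0 -> is_derive t 1 e (- A t * e t + B t) by case/lin.
have Ab t : - T <= t <= 0 -> c <= A t <= C by case/lin.
have Bb t : - T <= t <= 0 -> `|B t| <= C * `|d t| by case/lin.
have T0' : - T <= 0 by rewrite oppr_le0 ltW.
have [E [eE [t1 t1T E1]]] :=
  norm_max_segment T0' (fun t tT => is_derive_continuous (eD t tT)).
have [D [dDb [t2 t2T D2]]] :=
  norm_max_segment T0' (fun t tT => is_derive_continuous (dD t tT)).
have E0 : 0 <= E by rewrite -E1.
have D0 : 0 <= D by rewrite -D2.
exists E, D; split => // [t tT|s sT]; first by split; [exact: eE|exact: dDb].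
have C0 : 0 <= C by lra.
have ge t : - T <= t <= 0 -> `|e t - e s| <= T * C * (E + D).
  move=> tT; rewrite -mulrA; apply: (segment_growth T0 eD) => // [r rT|]; last first.
    by rewrite mulr_ge0// addr_ge0.
  apply: (le_trans (ler_normD _ _)); rewrite mulrDr; apply: lerD; last first.
    by apply: le_trans (Bb r rT) _; rewrite ler_wpM2l// dDb.
  rewrite normrM normrN; apply: ler_pM => //; last exact: eE.
  by have /andP[? ?] := Ab r rT; rewrite ler_norml; lra.
have de t : - T <= t <= 0 -> `|d t - d s| <= T * E.
  by move=> tT; apply: (segment_growth T0 dD).
split => //.
  rewrite -{1}E1 -lerBlDl; apply: le_trans (ge _ t1T).
  exact: lerB_dist.
rewrite -{1}D2 -lerBlDl; apply: le_trans (de _ t2T).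
exact: lerB_dist.
Qed.

(** By the mean value theorem [e 0] is [(1 - T * A x) * e (- T)] up to terms of second order in [T]
    and terms in [d]. The coefficient of [|d (- T)|] may be crude, since it does not affect the
    area. *)
Lemma velocity_contraction d e A B T c C :
  0 < T -> 1 <= C -> 0 <= c -> T * C <= 4^-1 ->
  linear_segment d e A B T c C ->
  `|e 0| <= (1 - c * T + 5 * C ^+ 2 * T ^+ 2) * `|e (- T)| + `|d (- T)|.
Proof.
move=> T0 C1 c0 TC lin.
have T4 : T <= 4^-1 by apply: le_trans TC; rewrite ler_peMr// ltW.
have [E [D [E0 D0 ED /(_ (- T))[|ge gd Es Ds]]]] := linear_segment_bounds T0 C1 c0 lin; first by lra.
have T0' : - T < 0 by lra.
have eD t : - T <= t <= 0 -> is_derive t 1 e (- A t * e t + B t) by case/lin.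
have [x xT] := mvt T0' eD.
have xT' : - T <= x <= 0 by lra.
rewrite opprK add0r => eE.
have {}eE : e 0 = e (- T) * (1 - T * A x) - T * A x * (e x - e (- T)) + T * B x.
  by rewrite -[LHS](subrK (e (- T))) eE; ring.
have [_ _ /andP[cA AC] Bx] := lin x xT'.
have C0 : 0 <= C by lra.
have A0 : 0 <= A x by lra.
have TA : T * A x <= T * C by rewrite ler_wpM2l// ltW.
have b1 : `|e (- T) * (1 - T * A x)| <= (1 - c * T) * `|e (- T)|.
  rewrite normrM mulrC ler_wpM2r// ger0_norm; last by lra.
  by have : T * c <= T * A x by [rewrite ler_wpM2l// ltW]; lra.
have b2 : `|T * A x * (e x - e (- T))| <= T * C * (T * C * (E + D)).
  rewrite normrM; apply: ler_pM => //; last exact: ge.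
  by rewrite ger0_norm// mulr_ge0// ltW.
have b3 : `|T * B x| <= T * (C * D).
  rewrite normrM; apply: ler_pM => //; first by rewrite ger0_norm// ltW.
  by apply: (le_trans Bx); rewrite ler_wpM2l//; exact: (ED _ xT').2.
have b4 : `|e 0| <= (1 - c * T) * `|e (- T)| + T * C * (T * C * (E + D)) + T * (C * D).
  rewrite eE (le_trans (ler_normD _ _))// lerD//.
  by rewrite (le_trans (ler_normB _ _))// lerD.
apply: (le_trans b4).
have h0 := normr_ge0 (e (- T)); have k0 := normr_ge0 (d (- T)).
set h := `|e (- T)| in h0 Es *; set k := `|d (- T)| in k0 Ds *.
set q := T * C in TC Es *.
have -> : 5 * C ^+ 2 * T ^+ 2 = 5 * q ^+ 2 by rewrite /q; ring.
have -> : T * (C * D) = q * D by rewrite mulrA.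
have q0 : 0 <= q by rewrite mulr_ge0// ltW.
have Tq : T <= q by rewrite ler_peMr// ltW.
clearbody q h k.
have qD : q * D <= 4^-1 * D by rewrite ler_wpM2r.
have qE : q * E <= 4^-1 * E by rewrite ler_wpM2r.
have TE : T * E <= q * E by rewrite ler_wpM2r.
(* The implicit inequalities are solved for [E] and [D], using [q <= 1/4]. *)
have Eb : E <= 2 * h + k by lra.
have Db : D <= k + 2 * (q * h) + q * k.
  have : q * E <= q * (2 * h + k) by rewrite ler_wpM2l.
  lra.
have qh : q * h <= 4^-1 * h by rewrite ler_wpM2r.
have qk : q * k <= 4^-1 * k by rewrite ler_wpM2r.
have s1 : q * (q * (E + D)) <= q * (q * (5 / 2 * h + 9 / 4 * k)).
  by do 2 (apply: ler_wpM2l => //); lra.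
have s2 : q * D <= q * (k + 2 * (q * h) + q * k) by rewrite ler_wpM2l.
have s3 : q * (q * k) <= 4^-1 * (4^-1 * k) by apply: ler_pM => //; exact: mulr_ge0.
have s4 : 0 <= q * (q * h) by do 2 (apply: mulr_ge0 => //).
lra.
Qed.

(** The estimate uses the final velocity [e 0], which vanishes along a line of fixed U. Then [e] is
    of order [T] times [d] on the segment, and as [d' = e] the position difference changes only to
    second order in [T]. *)
Lemma position_expansion d e A B T c C :
  0 < T -> 1 <= C -> 0 <= c -> T * C <= 4^-1 ->
  linear_segment d e A B T c C ->
  (1 - 3 * C * T ^+ 2) * `|d 0| <= `|d (- T)| + `|e 0|.
Proof.
move=> T0 C1 c0 TC lin.
have T4 : T <= 4^-1 by apply: le_trans TC; rewrite ler_peMr// ltW.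
have [E [D [E0 D0 ED /(_ 0)[|ge gd Es Ds]]]] := linear_segment_bounds T0 C1 c0 lin; first by lra.
have C0 : 0 <= C by lra.
have := gd (- T); rewrite lexx oppr_le0 ltW// => /(_ isT) dT.
have dd : `|d 0| <= `|d (- T)| + T * E.
  rewrite -lerBlDl; apply: le_trans dT; rewrite distrC; exact: lerB_dist.
have h0 := normr_ge0 (e 0); have k0 := normr_ge0 (d 0).
set h := `|e 0| in h0 Es *; set k := `|d 0| in k0 Ds dd *.
set k' := `|d (- T)| in dd *.
have qE : T * C * E <= 4^-1 * E by rewrite ler_wpM2r.
have TE : T * E <= 4^-1 * E by rewrite ler_wpM2r.
have qD : T * C * D <= 4^-1 * D by rewrite ler_wpM2r.
have E1 : E <= 4 / 3 * (h + T * C * D) by lra.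
have D1 : D <= 2 * k + h by lra.
have q0 : 0 <= T * C by rewrite mulr_ge0// ltW.
have E2 : T * E <= T * (4 / 3 * (h + T * C * (2 * k + h))).
  apply: ler_wpM2l; first exact: ltW.
  have : T * C * D <= T * C * (2 * k + h) by rewrite ler_wpM2l.
  lra.
have s1 : T * h <= 4^-1 * h by rewrite ler_wpM2r.
have s2 : T * (T * C * h) <= 4^-1 * (4^-1 * h).
  have qh : T * C * h <= 4^-1 * h by rewrite ler_wpM2r.
  by apply: ler_pM => //; [exact: ltW|exact: mulr_ge0].
have s3 : 0 <= T * (T * C * k) by rewrite !mulr_ge0// ltW.
lra.
Qed.

End estimates.

(** * Points whose past stays in a bounded region form a null set *)

Section trapped.
Context {R : realType}.
Local Notation leb := (@lebesgue_measure R).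
Implicit Types (V dV phi u K : R -> R) (n M : R).

(** The cosmological system in the time t; [K] enters as the positive root of the constraint. *)
Definition past_trajectory V dV n phi u K := forall t : R, t <= 0 ->
  [/\ is_derive t 1 phi (u t), is_derive t 1 u (- (K t * u t) - dV (phi t)),
      K t ^+ 2 = 3 * V (phi t) + 3 / 2 * u t ^+ 2,
      n^-1 <= K t <= n & `|phi t| <= n].

Definition trapped V dV n : set (R * R) :=
  [set z | exists phi u K, past_trajectory V dV n phi u K /\ (phi 0, u 0) = z].

Lemma past_trajectory_shift V dV n phi u K (T : R) : 0 <= T ->
  past_trajectory V dV n phi u K ->
  past_trajectory V dV n (fun t => phi (t - T)) (fun t => u (t - T)) (fun t => K (t - T)).
Proof.
move=> T0 tr t t0.
have [|phiD uD KE Kn phin] := tr (t - T); first by lra.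
have sD : is_derive t 1 (fun s : R => s - T) 1 by apply: is_derive_eq; exact: subr0.
split => //.
- by rewrite -[X in is_derive _ _ _ X]mulr1; exact: (is_derive1_comp (f := phi)).
- by rewrite -[X in is_derive _ _ _ X]mulr1; exact: (is_derive1_comp (f := u)).
Qed.

Lemma velocity_bound V dV n phi u K : 0 < n -> (forall s, 0 <= V s) ->
  past_trajectory V dV n phi u K -> forall t : R, t <= 0 -> `|u t| <= n.
Proof.
move=> n0 V0 tr t t0; have [_ _ KE /andP[nK Kn] phin] := tr t t0.
have K0 : 0 <= K t by rewrite (le_trans _ nK)// invr_ge0 ltW.
rewrite -(@ler_pXn2r _ 2) ?nnegrE ?(ltW n0)// real_normK ?num_real//.
have : K t ^+ 2 <= n ^+ 2 by rewrite ler_pXn2r ?nnegrE ?(ltW n0)//.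
have := sqr_ge0 (u t); have := V0 (phi t); lra.
Qed.

(** [K1 u1 - K2 u2] is split symmetrically into [S / 2 * (u1 - u2)] and [(u1 + u2) / 2 * (K1 - K2)],
    where [S = K1 + K2]. The constraint expresses [K1 - K2 = (K1 ^+ 2 - K2 ^+ 2) / S] through the
    differences of V and u; its u-part adds a non-negative term to the damping, which therefore
    stays above [n^-1]. *)
Lemma trajectories_linear_segment V dV n M phi1 u1 K1 phi2 u2 K2 (T : R) :
  0 < n -> 0 <= M -> (forall s, 0 <= V s) ->
  (forall x y, `|x| <= n -> `|y| <= n -> `|V x - V y| <= M * `|x - y|) ->
  (forall x y, `|x| <= n -> `|y| <= n -> `|dV x - dV y| <= M * `|x - y|) ->
  past_trajectory V dV n phi1 u1 K1 -> past_trajectory V dV n phi2 u2 K2 ->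
  exists A B, linear_segment (fun t => phi1 t - phi2 t) (fun t => u1 t - u2 t) A B T
    n^-1 (1 + n + 3 / 2 * n ^+ 3 + M + 3 / 2 * n ^+ 2 * M).
Proof.
move=> n0 M0 V0 VM dVM tr1 tr2.
pose S t := K1 t + K2 t.
exists (fun t => S t / 2 + 3 / 4 * (u1 t + u2 t) ^+ 2 / S t).
exists (fun t => - (dV (phi1 t) - dV (phi2 t)) -
  3 / 2 * (u1 t + u2 t) * (V (phi1 t) - V (phi2 t)) / S t).
move=> t /andP[_ t0].
have [p1 v1 E1 /andP[nK1 K1n] n1] := tr1 t t0.
have [p2 v2 E2 /andP[nK2 K2n] n2] := tr2 t t0.
have ni0 : 0 < n^-1 by rewrite invr_gt0.
have un1 : `|u1 t| <= n := velocity_bound n0 V0 tr1 t0.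
have un2 : `|u2 t| <= n := velocity_bound n0 V0 tr2 t0.
have S0 : 0 < S t by rewrite /S; lra.
have wS : S t * (S t)^-1 = 1 by rewrite divff// gt_eqF.
have w0 : 0 < (S t)^-1 by rewrite invr_gt0.
have wn : (S t)^-1 <= n / 2.
  rewrite -[leRHS]invrK lef_pV2 ?posrE ?invr_gt0 ?divr_gt0// invf_div.
  by rewrite /S; lra.
set w := (S t)^-1 in wS w0 wn *.
have un : `|u1 t + u2 t| <= 2 * n by rewrite (le_trans (ler_normD _ _))//; lra.
have KE : K1 t - K2 t = (3 * (V (phi1 t) - V (phi2 t)) +
    3 / 2 * (u1 t - u2 t) * (u1 t + u2 t)) * w.
  transitivity ((K1 t - K2 t) * S t * w); first by rewrite -mulrA wS mulr1.
  congr (_ * w).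
  transitivity (K1 t ^+ 2 - K2 t ^+ 2); first by rewrite /S; ring.
  by rewrite E1 E2; ring.
split.
- exact: is_deriveB.
- have -> : - (S t / 2 + 3 / 4 * (u1 t + u2 t) ^+ 2 * w) * (u1 t - u2 t) +
    (- (dV (phi1 t) - dV (phi2 t)) -
      3 / 2 * (u1 t + u2 t) * (V (phi1 t) - V (phi2 t)) * w) =
    (- (K1 t * u1 t) - dV (phi1 t)) - (- (K2 t * u2 t) - dV (phi2 t)).
    have -> : (- (K1 t * u1 t) - dV (phi1 t)) - (- (K2 t * u2 t) - dV (phi2 t)) =
      - (S t / 2) * (u1 t - u2 t) - (u1 t + u2 t) / 2 * (K1 t - K2 t)
      - (dV (phi1 t) - dV (phi2 t)) by rewrite /S; field.
    by rewrite KE; field.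
  exact: is_deriveB.
- have sq : (u1 t + u2 t) ^+ 2 <= (2 * n) ^+ 2.
    by rewrite -real_normK ?num_real// ler_pXn2r ?nnegrE// mulr_ge0// ltW.
  have sqw : (u1 t + u2 t) ^+ 2 * w <= (2 * n) ^+ 2 * (n / 2).
    by apply: ler_pM => //; [exact: sqr_ge0|exact: ltW].
  have sq0 : 0 <= (u1 t + u2 t) ^+ 2 * w by rewrite mulr_ge0 ?sqr_ge0// ltW.
  have e : (2 * n) ^+ 2 * (n / 2) = 2 * n ^+ 3 by field.
  have nM : 0 <= n ^+ 2 * M by rewrite mulr_ge0// sqr_ge0.
  have n3 : 0 <= n ^+ 3 by rewrite exprn_ge0// ltW.
  by rewrite /S -mulrA; apply/andP; split; lra.
- set D := `|phi1 t - phi2 t|; have D0 : 0 <= D by exact: normr_ge0.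
  apply: (@le_trans _ _ (M * D + 3 / 2 * (2 * n) * (M * D) * (n / 2))); last first.
    have -> : 3 / 2 * (2 * n) * (M * D) * (n / 2) = 3 / 2 * n ^+ 2 * M * D by field.
    rewrite !mulrDl.
    have h1 : 0 <= n * D by rewrite mulr_ge0// ltW.
    have h2 : 0 <= 3 / 2 * n ^+ 3 * D.
      by do 2 (apply: mulr_ge0 => //); rewrite exprn_ge0// ltW.
    lra.
  rewrite (le_trans (ler_normB _ _))//; apply: lerD.
    by rewrite normrN; exact: dVM.
  rewrite 3!normrM (ger0_norm (ltW w0)).
  apply: ler_pM => //; first by rewrite ltW.
  apply: ler_pM => //; last exact: VM.
  by rewrite ger0_norm// ler_pM.
Qed.

Lemma trapped_negligible V dV n M :
  1 <= n -> 0 <= M -> (forall s, 0 <= V s) ->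
  (forall x y, `|x| <= n -> `|y| <= n -> `|V x - V y| <= M * `|x - y|) ->
  (forall x y, `|x| <= n -> `|y| <= n -> `|dV x - dV y| <= M * `|x - y|) ->
  (leb \x leb)%E.-negligible (trapped V dV n).
Proof.
move=> n1 M0 V0 VM dVM.
have n0 : 0 < n by lra.
pose C := 1 + n + 3 / 2 * n ^+ 3 + M + 3 / 2 * n ^+ 2 * M.
have n3 : 0 <= n ^+ 3 by rewrite exprn_ge0// ltW.
have nM : 0 <= n ^+ 2 * M by rewrite mulr_ge0// sqr_ge0.
have C1 : 1 <= C by rewrite /C; lra.
have C0 : 0 < C by lra.
pose c := n^-1.
have c0 : 0 < c by rewrite invr_gt0.
have c1 : c <= 1 by rewrite invf_le1.
(* For this [T] the errors [5 * C ^+ 2 * T ^+ 2] and [3 * C * T ^+ 2] are at most 5/32 and 3/32 of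
   the gain [c * T], so the product of the two Lipschitz constants is below 1. *)
pose T := c / (32 * C ^+ 2).
have CC0 : 0 < C ^+ 2 by rewrite exprn_gt0.
have T0 : 0 < T by rewrite divr_gt0// mulr_gt0.
have CTE : C ^+ 2 * T = c / 32 by rewrite /T; field; rewrite gt_eqF.
have CCC : C <= C ^+ 2 by rewrite expr2 ler_peMl// ltW.
have CT : C * T <= C ^+ 2 * T by rewrite ler_wpM2r// ltW.
have TCT : T <= C * T by rewrite ler_peMl// ltW.
have T1 : T <= 32^-1 by lra.
have cT : c * T <= 32^-1 by rewrite -[leRHS]mul1r; apply: ler_pM => //; apply: ltW.
have cT0 : 0 < c * T by rewrite mulr_gt0.
have s1 : C ^+ 2 * T ^+ 2 = c * T / 32 by rewrite expr2 mulrA CTE; field.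
have s2 : C * T ^+ 2 <= c * T / 32.
  by rewrite -s1 ler_wpM2r// sqr_ge0.
have s20 : 0 <= C * T ^+ 2 by rewrite mulr_ge0 ?sqr_ge0// ltW.
have TC4 : T * C <= 4^-1 by rewrite mulrC; lra.
(* The graph of the time [T] map along trapped trajectories. Shifting a trajectory by [T] shows that
   its starting points are again end points. *)
pose P := [set z | exists phi u K, past_trajectory V dV n phi u K /\
  ((phi (- T), u (- T)), (phi 0, u 0)) = z].
have -> : trapped V dV n = snd @` P.
  apply/seteqP; split => [_ [phi [u [K [tr <-]]]]|_ [_ [phi [u [K [tr <-]]]] <-]].
    by exists ((phi (- T), u (- T)), (phi 0, u 0)) => //; exists phi, u, K.
  by exists phi, u, K.
have q0 : 0 < 1 - 3 * C * T ^+ 2 by lra.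
apply: (@negligible_contraction R P (1 - c * T + 5 * C ^+ 2 * T ^+ 2)
  (1 - 3 * C * T ^+ 2)^-1 2 n).
- by lra.
- by rewrite invr_gt0.
- by rewrite ltr_pdivrMr// mul1r; lra.
- move=> _ [phi [u [K [tr <-]]]] /=.
  have un := velocity_bound n0 V0 tr.
  have [|_ _ _ _ pT] := tr (- T); first by lra.
  have [//|_ _ _ _ p0] := tr 0.
  by split => //; apply: un; lra.
- move=> _ _ [phi1 [u1 [K1 [tr1 <-]]]] [phi2 [u2 [K2 [tr2 <-]]]] /=.
  have [A [B lin]] := trajectories_linear_segment T n0 M0 V0 VM dVM tr1 tr2.
  apply: le_trans (velocity_contraction T0 C1 (ltW c0) TC4 lin) _ => /=.
  rewrite lerD2l ler_peMl//; lra.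
- move=> _ _ [phi1 [u1 [K1 [tr1 <-]]]] [phi2 [u2 [K2 [tr2 <-]]]] /=.
  have [A [B lin]] := trajectories_linear_segment T n0 M0 V0 VM dVM tr1 tr2.
  have := position_expansion T0 C1 (ltW c0) TC4 lin.
  rewrite mulrC -ler_pdivlMr// => /le_trans; apply => /=.
  rewrite mulrDl mulrC lerD2l mulrC; apply: ler_wpM2r => //.
  by rewrite invf_ple ?posrE//; lra.
- move=> _ [_ [phi [u [K [tr <-]]]] <-] /=.
  have tr' := past_trajectory_shift (ltW T0) tr.
  exists ((phi (- T - T), u (- T - T)), (phi (- T), u (- T))) => //.
  exists (fun t => phi (t - T)), (fun t => u (t - T)), (fun t => K (t - T)).
  by split => //; rewrite !add0r.
Qed.

End trapped.

(** * The flow in the time tau *)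

Section bounded_lipschitz.
Context {R : realType} {I : Type}.
Implicit Types (G H : (I -> R) -> R) (b c M x y : R) (i : I).

(** Boundedness is kept together with the Lipschitz property, in the supremum distance, so that the
    class is closed under products. *)
Definition bounded_lipschitz G := exists2 B : R, (forall z, `|G z| <= B) &
  forall z w r, (forall j, `|z j - w j| <= r) -> 0 <= r -> `|G z - G w| <= B * r.

Lemma bounded_lipschitz_ge0 G B : (forall z, `|G z| <= B) -> 0 <= B.
Proof. by move=> /(_ (fun=> 0)); apply: le_trans. Qed.

Lemma bounded_lipschitz_cst c : bounded_lipschitz (fun=> c).
Proof. by exists `|c| => // z w r _ r0; rewrite subrr normr0 mulr_ge0. Qed.

Lemma bounded_lipschitzD G H : bounded_lipschitz G -> bounded_lipschitz H ->
  bounded_lipschitz (fun z => G z + H z).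
Proof.
move=> [B GB GL] [B' HB HL]; exists (B + B') => [z|z w r zw r0].
  by rewrite (le_trans (ler_normD _ _))// lerD.
have -> : G z + H z - (G w + H w) = (G z - G w) + (H z - H w) by ring.
by rewrite (le_trans (ler_normD _ _))// mulrDl lerD ?GL ?HL.
Qed.

Lemma bounded_lipschitzM G H : bounded_lipschitz G -> bounded_lipschitz H ->
  bounded_lipschitz (fun z => G z * H z).
Proof.
move=> [B GB GL] [B' HB HL].
have B0 := bounded_lipschitz_ge0 GB; have B'0 := bounded_lipschitz_ge0 HB.
have BB0 : 0 <= B * B' by exact: mulr_ge0.
exists (2 * (B * B')) => [z|z w r zw r0].
  rewrite normrM; apply: (@le_trans _ _ (B * B')); first exact: ler_pM.
  lra.
have -> : G z * H z - G w * H w = (G z - G w) * H z + G w * (H z - H w) by ring.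
rewrite (le_trans (ler_normD _ _))// !normrM.
have -> : 2 * (B * B') * r = B * r * B' + B * (B' * r) by ring.
by apply: lerD; apply: ler_pM => //; [exact: GL|exact: HL].
Qed.

Lemma bounded_lipschitz_comp G (h : R -> R) :
  (forall N, exists2 M, 0 <= M & (forall x, `|x| <= N -> `|h x| <= M) /\
    forall x y, `|x| <= N -> `|y| <= N -> `|h x - h y| <= M * `|x - y|) ->
  bounded_lipschitz G -> bounded_lipschitz (fun z => h (G z)).
Proof.
move=> hL [B GB GL]; have B0 := bounded_lipschitz_ge0 GB.
have [M M0 [hM hM']] := hL B; have MB : 0 <= M * B by exact: mulr_ge0.
exists (M * B + M) => [z|z w r zw r0].
  by apply: le_trans (hM _ (GB z)) _; rewrite lerDr.
apply: le_trans (hM' _ _ (GB z) (GB w)) _; rewrite mulrDl ler_wpDr ?mulr_ge0//.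
by rewrite -mulrA ler_wpM2l// GL.
Qed.

Lemma min_lipschitz b x y : `|Num.min x b - Num.min y b| <= `|x - y|.
Proof.
have := ler_norm (x - y); have := ler_norm (y - x); rewrite distrC ler_norml.
by case: (leP x b) => ?; case: (leP y b) => ? ? ?; apply/andP; split; lra.
Qed.

Lemma max_lipschitz b x y : `|Num.max b x - Num.max b y| <= `|x - y|.
Proof.
have := ler_norm (x - y); have := ler_norm (y - x); rewrite distrC ler_norml.
by case: (leP b x) => ?; case: (leP b y) => ? ? ?; apply/andP; split; lra.
Qed.

Definition clip b x : R := Num.max (- b) (Num.min x b).

Lemma clip_id b x : `|x| <= b -> clip b x = x.
Proof.
by rewrite ler_norml /clip => /andP[bx xb]; rewrite (min_idPl xb); apply/max_idPr.
Qed.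

Lemma bounded_lipschitz_clip b i : 0 <= b -> bounded_lipschitz (fun z => clip b (z i)).
Proof.
move=> b0; exists (b + 1) => [z|z w r /(_ i) zw r0].
  rewrite (@le_trans _ _ b)// ?lerDl// ler_norml /clip le_max lexx/= ge_max.
  by rewrite ge_min lexx orbT andbT; lra.
rewrite mulrDl mul1r ler_wpDl ?mulr_ge0//; apply: le_trans zw.
by apply: le_trans (max_lipschitz _ _ _) _; exact: min_lipschitz.
Qed.

(** Cutting from above suffices, since the exponential and its derivative are bounded on a left
    half-line; [c + 1] makes room for an open interval containing [c]. *)
Lemma bounded_lipschitz_expR_min c i :
  bounded_lipschitz (fun z => expR (Num.min (z i) c)).
Proof.
exists (expR (c + 1)) => [z|z w r /(_ i) zw r0].
  by rewrite ger0_norm ?expR_ge0// ler_expR ge_min; apply/orP; right; lra.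
have ce x y : x <= c -> y <= c -> `|expR x - expR y| <= expR (c + 1) * `|x - y|.
  move=> xc yc; pose m := `|x| + `|y| + 1.
  have lo v : `|v| < m -> - m < v by rewrite ltr_norml => /andP[].
  have eb v : - m < v < c + 1 -> `|expR v| <= expR (c + 1).
    by move=> /andP[_ vc]; rewrite ger0_norm ?expR_ge0// ler_expR ltW.
  have := normr_ge0 x; have := normr_ge0 y => x0 y0.
  apply: (derive_lipschitz (fun v _ => is_derive_expR v) eb); apply/andP; split;
    by [lra|apply: lo; rewrite /m; lra].
apply: le_trans (ce _ _ _ _) _; try by rewrite ge_min lexx orbT.
rewrite ler_wpM2l ?expR_ge0//; apply: le_trans zw.
exact: min_lipschitz.
Qed.

End bounded_lipschitz.

Section flow.
Context {R : realType}.
Local Notation a := (Num.sqrt (3 / 2) : R).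
Local Notation b := (Num.sqrt (2 / 3) : R).

Lemma sqrt32_sqr : a ^+ 2 = 3 / 2. Proof. by rewrite sqr_sqrtr// divr_ge0. Qed.
Lemma sqrt23_sqr : b ^+ 2 = 2 / 3. Proof. by rewrite sqr_sqrtr// divr_ge0. Qed.
Lemma sqrt32_sqrt23 : a * b = 1.
Proof.
rewrite -sqrtrM ?divr_ge0//.
have -> : 3 / 2 * (2 / 3) = 1 :> R by field.
by rewrite sqrtr1.
Qed.

Lemma sqrt23E : b = 2 / 3 * a.
Proof.
transitivity (a * b * b); first by rewrite sqrt32_sqrt23 mul1r.
by rewrite -mulrA -expr2 sqrt23_sqr mulrC.
Qed.

Lemma is_derive_expRN (l : R -> R) (s d : R) : is_derive s 1 l d ->
  is_derive s 1 (fun s => expR (- l s)) (- d * expR (- l s)).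
Proof.
move=> lD; have nD : is_derive s 1 (fun s => - l s) (- d) by exact: is_deriveN.
by rewrite mulrC; exact: (is_derive1_comp (g := fun s => - l s) (is_derive_expR _) nD).
Qed.

Lemma constraint_normalized (l y v : R) :
  (y ^+ 2 - 1) * expR (- l) ^+ 2 + 3 * v = 0 -> y ^+ 2 + 3 * expR l ^+ 2 * v = 1.
Proof.
move=> E; have XK : expR l * expR (- l) = 1 by rewrite -expRD subrr expR0.
have : ((y ^+ 2 - 1) * expR (- l) ^+ 2 + 3 * v) * expR l ^+ 2 = 0 by rewrite E mul0r.
have -> : ((y ^+ 2 - 1) * expR (- l) ^+ 2 + 3 * v) * expR l ^+ 2 =
  (y ^+ 2 - 1) * (expR l * expR (- l)) ^+ 2 + 3 * v * expR l ^+ 2 by ring.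
by rewrite XK; lra.
Qed.

(** Multiplied by K^2, the constraint becomes an exact first integral. For
    [y ^+ 2 + 3 * x ^+ 2 * V - 1] itself the derivative would only be proportional to that
    expression. *)
Lemma constraint_derive (V dV : R -> R) (l y phi : R -> R) s :
  is_derive (phi s) 1 V (dV (phi s)) ->
  is_derive s 1 l (y s ^+ 2) ->
  is_derive s 1 y (- y s - a * expR (l s) ^+ 2 * dV (phi s) + y s ^+ 3) ->
  is_derive s 1 phi (b * y s) ->
  is_derive s 1 (fun s => (y s ^+ 2 - 1) * expR (- l s) ^+ 2 + 3 * V (phi s)) 0.
Proof.
move=> VD lD yD phiD.
have VphiD : is_derive s 1 (V \o phi) (dV (phi s) * (b * y s)) by exact: is_derive1_comp.
have eD := is_derive_expRN lD.
pose X := expR (l s).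
have XK : X * expR (- l s) = 1 by rewrite -expRD subrr expR0.
apply: (@is_derive_eq _ _ _ (fun s => (y s ^+ 2 - 1) * expR (- l s) ^+ 2 + 3 * (V \o phi) s)).
rewrite /GRing.scale/= sqrt23E.
transitivity (2 * a * y s * dV (phi s) * (1 - (X * expR (- l s)) ^+ 2)).
  by rewrite /X; field.
by rewrite XK expr1n subrr mulr0.
Qed.

(* The system is clipped to |y| <= 2, |phi| <= M + 1 and l <= l 0 + 1, where
   l = ln x.  A point of the past trajectory that satisfies the original system down
   to it has |y| <= 1 and |phi| <= M, the latter because it lies in the past orbit;
   as the clipped field is bounded, the clipping stays inactive for a further time
   del, and the argument can be iterated. *)
Lemma past_flow (V : R -> R) (p : state R) (M : R) :
  (forall s, 0 <= V s) ->
  (forall x : R, is_derive x 1 V (derive1 V x)) ->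
  (forall N : R, exists2 M, 0 <= M & (forall x, `|x| <= N -> `|derive1 V x| <= M) /\
    forall x y, `|x| <= N -> `|y| <= N ->
      `|derive1 V x - derive1 V y| <= M * `|x - y|) ->
  Omega V p -> `|scalar_field p| <= M ->
  (forall q, past_orbit V p q -> `|scalar_field q| <= M) ->
  exists l w y phi : R -> R,
  [/\ forall s : R, is_derive s 1 l (w s), forall s : R, 0 <= w s,
     [/\ expR (l 0) = (hubble p)^-1, y 0 = a * field_velocity p / hubble p
       & phi 0 = scalar_field p] &
     forall s : R, s <= 0 -> [/\ w s = y s ^+ 2,
       is_derive s 1 y (- y s - a * expR (l s) ^+ 2 * derive1 V (phi s) + y s ^+ 3),
       is_derive s 1 phi (b * y s),
       (y s ^+ 2 - 1) * expR (- l s) ^+ 2 + 3 * V (phi s) = 0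
     & `|phi s| <= M]].
Proof.
move=> V0 VD dVL [K0 KE] pM orbM.
case: p K0 KE pM orbM => k f u /= K0 KE pM orbM.
have M0 : 0 <= M := le_trans (normr_ge0 _) pM.
pose dV : R -> R := derive1 V.
(* The logarithm of x replaces x, which keeps x positive. In the index type below, [None] stands for
   l, [Some true] for y and [Some false] for phi. *)
pose l0 := - ln k.
have El0 : expR l0 = k^-1 by rewrite expRN lnK.
have El0' : expR (- l0) = k by rewrite opprK lnK.
pose y0 := a * u / k.
pose Y (z : option bool -> R) := clip 2 (z (Some true)).
pose X (z : option bool -> R) := expR (Num.min (z None) (l0 + 1)).
pose P (z : option bool -> R) := clip (M + 1) (z (Some false)).
pose Fy (z : option bool -> R) : R := - 1 * Y z + (- a) * (X z * X z * dV (P z)) + Y z * Y z * Y z.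
pose F (z : option bool -> R) (i : option bool) : R := match i with
  | None => Y z * Y z | Some true => Fy z | Some false => b * Y z end.
have bY : bounded_lipschitz Y by exact: bounded_lipschitz_clip.
have bX : bounded_lipschitz X by exact: bounded_lipschitz_expR_min.
have bP : bounded_lipschitz (fun z => dV (P z)).
  by apply: bounded_lipschitz_comp => //; apply: bounded_lipschitz_clip; lra.
have bF i : bounded_lipschitz (F ^~ i).
  have bc := @bounded_lipschitz_cst R (option bool).
  case: i => [[]|] /=; last exact: bounded_lipschitzM.
    by rewrite /Fy; repeat (apply: bounded_lipschitzD || apply: bounded_lipschitzM).
  exact: bounded_lipschitzM.
have [B [B0 FB FL]] : exists B : R, [/\ 0 <= B, forall z i, `|F z i| <= B &
    forall (z w : option bool -> R) i (r : R),
    (forall j, `|z j - w j| <= r) -> `|F z i - F w i| <= B * r].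
  have /choice[Bi BiP] : forall i, exists B : R, (forall z, `|F z i| <= B) /\
      forall (z w : option bool -> R) (r : R), (forall j, `|z j - w j| <= r) -> 0 <= r -> `|F z i - F w i| <= B * r.
    by move=> i; have [B ? ?] := bF i; exists B.
  have Bi0 i : 0 <= Bi i by apply: bounded_lipschitz_ge0 (BiP i).1.
  pose B : R := Bi None + Bi (Some true) + Bi (Some false).
  have BiB i : Bi i <= B.
    have := Bi0 None; have := Bi0 (Some true); have := Bi0 (Some false).
    by rewrite /B; case: i => [[]|]; lra.
  exists B; split => [|z i|z w i r zw].
  - by rewrite !addr_ge0.
  - exact: le_trans ((BiP i).1 z) (BiB i).
  - have r0 : 0 <= r by rewrite (le_trans _ (zw None)).
    by apply: le_trans ((BiP i).2 z w r zw r0) _; rewrite ler_wpM2r.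
pose z0 (i : option bool) : R := match i with
  | None => l0 | Some true => y0 | Some false => f end.
have [z [zi zD]] := picard_global z0 FB FL.
pose l := z None; pose y := z (Some true); pose phi := z (Some false).
have zB i (s t : R) : `|z i s - z i t| <= B * `|s - t|.
  pose m := `|s| + `|t| + 1.
  apply: (@derive_lipschitz _ (z i) (fun s => F (z ^~ s) i) (- m) m) => //.
  - by rewrite -ltr_norml ltr_pwDr// lerDl.
  - by rewrite -ltr_norml ltr_pwDr// lerDr.
pose w (s : R) : R := Y (z ^~ s) * Y (z ^~ s).
have lD (s : R) : is_derive s 1 l (w s) := zD None s.
have w0 (s : R) : 0 <= w s by rewrite /w -expr2 sqr_ge0.
have lmono (s t : R) : s <= t -> l s <= l t.
  by move=> st; apply: (derive_ge0_le st (fun x _ => lD x) (fun x _ => w0 x)).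
(* Each component moves by at most 1 within the time [del], which is the margin left by the clipping
   of y and phi. *)
pose del := (B + 1)^-1.
have del0 : 0 < del by rewrite invr_gt0 ltr_wpDl.
have Bdel : B * del <= 1 by rewrite ler_pdivrMr ?mul1r ?lerDl// ltr_wpDl.
have near1 i (s t : R) : `|s - t| <= del -> `|z i s - z i t| <= 1.
  by move=> st; apply: le_trans (zB i s t) _; apply: le_trans Bdel; rewrite ler_wpM2l.
have lsmall (s : R) : s < del -> l s <= l0 + 1.
  move=> sd; have [s0|/ltW s0] := leP s 0.
    by apply: le_trans (lmono s 0 s0) _; rewrite /l zi /= lerDl.
  have := near1 None s 0; rewrite subr0 ger0_norm// => /(_ (ltW sd)).
  by rewrite zi ler_norml /= -/l => /andP[]; lra.
pose good (s : R) := `|y s| <= 2 /\ `|phi s| <= M + 1.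
have trueD (s : R) : s < del -> good s -> [/\ w s = y s ^+ 2,
    is_derive s 1 l (y s ^+ 2),
    is_derive s 1 y (- y s - a * expR (l s) ^+ 2 * dV (phi s) + y s ^+ 3) &
    is_derive s 1 phi (b * y s)].
  move=> sd [ys phis].
  have YE : Y (z ^~ s) = y s by exact: clip_id.
  have PE : P (z ^~ s) = phi s by exact: clip_id.
  have XE : X (z ^~ s) = expR (l s) by rewrite /X (min_idPl (lsmall _ sd)).
  have wE : w s = y s ^+ 2 by rewrite /w YE expr2.
  split => //.
  - by rewrite -wE.
  - have := zD (Some true) s; rewrite /F /Fy YE PE XE.
    by congr is_derive; ring.
  - by have := zD (Some false) s; rewrite /F YE.
(* While the clipping is inactive the constraint persists, and [V >= 0] gives [|y| <= 1]. The piece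
   is then a genuine solution on an open interval around 0, so its points lie in the past orbit,
   where phi is bounded by [M]. *)
have step (r : R) : 0 < r -> (forall s : R, - r < s < del -> good s) ->
    forall s : R, - r < s <= 0 ->
    [/\ (y s ^+ 2 - 1) * expR (- l s) ^+ 2 + 3 * V (phi s) = 0,
      `|y s| <= 1 & `|phi s| <= M].
  move=> r0 gd.
  pose g (s : R) : R := (y s ^+ 2 - 1) * expR (- l s) ^+ 2 + 3 * V (phi s).
  have gD (s : R) : - r < s < del -> is_derive s 1 g 0.
    move=> srd; have /andP[_ sd] := srd.
    have [_ lDs yDs pDs] := trueD s sd (gd s srd).
    exact: (@constraint_derive V dV).
  have g0 : g 0 = 0.
    rewrite /g /l /y /phi !zi /= El0' /y0.
    have -> : (a * u / k) ^+ 2 = a ^+ 2 * u ^+ 2 / k ^+ 2 by field; rewrite gt_eqF.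
    rewrite sqrt32_sqr mulrBl divfK ?expf_neq0 ?gt_eqF// mul1r KE; ring.
  have gE (s : R) : - r < s < del -> g s = 0.
    move=> srd; have dom0 : - r < 0 < del by rewrite oppr_lt0 r0.
    have cst0 (v : R) : - r < v < del -> `|(fun=> 0 : R) v| <= 0 by rewrite normr0.
    have := derive_lipschitz gD cst0 srd dom0.
    by rewrite mul0r normr_le0 g0 subr0 => /eqP.
  have yle (s : R) : - r < s < del -> y s ^+ 2 <= 1.
    move=> srd; have := gE s srd; rewrite /g => gs.
    have e0 : 0 < expR (- l s) ^+ 2 by rewrite exprn_gt0// expR_gt0.
    have : (y s ^+ 2 - 1) * expR (- l s) ^+ 2 <= 0 by have := V0 (phi s); lra.
    by rewrite pmulr_lle0// subr_le0.
  move=> s /andP[rs s0]; have srd : - r < s < del by rewrite rs (le_lt_trans s0).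
  split; first exact: gE.
    by rewrite -(@ler_pXn2r _ 2) ?nnegrE// expr1n real_normK ?num_real// yle.
  have gs := gE s srd.
  have e0 : 0 < expR (- l s) by exact: expR_gt0.
  have exv v : (expR (- l v))^-1 = expR (l v) by rewrite expRN invrK.
  pose q := State (expR (- l s)) (phi s) (b * y s * expR (- l s)).
  apply: (orbM q); split.
    split => //=.
    have -> : (b * y s * expR (- l s)) ^+ 2 = b ^+ 2 * (y s ^+ 2 * expR (- l s) ^+ 2) by ring.
    by rewrite sqrt23_sqr; move: gs; rewrite /g; lra.
  exists (- r), del, s, (fun s => expR (l s)), y, phi; split => //.
  - move=> v; rewrite /= in_itv/= => vrd; have /andP[_ vd] := vrd.
    have [_ lDv yDv pDv] := trueD v vd (gd v vrd).
    split => //.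
      rewrite mulrC; exact: (is_derive1_comp (g := l) (is_derive_expR _) lDv).
    exact/constraint_normalized/gE.
  - split; rewrite /normalized /=.
      by rewrite /l /y /phi !zi /= El0.
    rewrite exv; congr (_, _, _).
    by rewrite -exv !mulrA sqrt32_sqrt23 mul1r mulfK// gt_eqF.
have good_near (s t : R) : `|y t| <= 1 -> `|phi t| <= M -> `|s - t| <= del -> good s.
  move=> yt pt st; have := near1 (Some true) s t st; have := near1 (Some false) s t st.
  rewrite -/y -/phi; split.
    by rewrite -[y s](subrK (y t)) (le_trans (ler_normD _ _))//; lra.
  by rewrite -[phi s](subrK (phi t)) (le_trans (ler_normD _ _))//; lra.
have y01 : `|y 0| <= 1.
  rewrite /y zi /= -(@ler_pXn2r _ 2) ?nnegrE// expr1n real_normK ?num_real//.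
  have -> : y0 ^+ 2 = a ^+ 2 * u ^+ 2 / k ^+ 2 by rewrite /y0; field; rewrite gt_eqF.
  rewrite sqrt32_sqr ler_pdivrMr ?exprn_gt0// mul1r KE.
  by have := V0 f; lra.
have p0M : `|phi 0| <= M by rewrite /phi zi.
have all n : forall s : R, - (n.+1%:R * del) < s < del -> good s.
  elim: n => [|n IH] s /andP[ns sd].
    apply: (good_near s 0) => //; rewrite subr0 ler_norml ltW ?(ltW sd)//.
    by move: ns; rewrite mul1r.
  have n0 : 0 < n.+1%:R * del by rewrite mulr_gt0.
  have [ns'|sn'] := ltP (- (n.+1%:R * del)) s; first by apply: IH; rewrite ns'.
  (* This time is already covered by the induction hypothesis and is within [del] of [s]. *)
  have [|_ yt pt] := step _ n0 IH (Num.min (s + del) 0).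
  - rewrite lt_min oppr_lt0 n0 andbT ge_min lexx orbT andbT.
    by move: ns; rewrite -natr1 mulrDl mul1r; lra.
  apply: good_near yt pt _.
  by case: (leP (s + del) 0) => ?; rewrite ler_norml; lra.
exists l, w, y, phi; split => //.
  by split; rewrite /l /y /phi zi.
move=> s s0.
have [n sn] : exists n, - (n.+1%:R * del) < s.
  exists (Num.bound (`|s| / del)); rewrite ltrNl -ltr_pdivrMr//.
  rewrite -(ler0_norm s0); apply: (lt_trans (archi_boundP _)); last by rewrite ltr_nat.
  by rewrite divr_ge0// ltW.
have n0 : 0 < n.+1%:R * del by rewrite mulr_gt0.
have sd : s < del by rewrite (le_lt_trans s0).
have [|gs _ ps] := step _ n0 (all n) s; first by rewrite sn.
have [|wE _ yDs pDs] := trueD s sd; first by apply: (all n); rewrite sn.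
by split.
Qed.

Lemma log_scale_lower_bound (V : R -> R) (l w y phi : R -> R) (M W : R) :
  (forall s : R, is_derive s 1 l (w s)) -> (forall s, 0 <= w s) ->
  (forall x, `|x| <= M -> `|V x| <= W) ->
  (forall s : R, s <= 0 -> [/\ is_derive s 1 phi (b * y s),
     (y s ^+ 2 - 1) * expR (- l s) ^+ 2 + 3 * V (phi s) = 0 & `|phi s| <= M]) ->
  exists c, forall s, s <= 0 -> c <= l s.
Proof.
move=> lD w0 VW H.
have lmono (s t : R) : s <= t -> l s <= l t.
  by move=> st; apply: (derive_ge0_le st (fun x _ => lD x) (fun x _ => w0 x)).
have M0 : 0 <= M.
  by have [//|_ _ p0] := H 0; exact: le_trans (normr_ge0 _) p0.
have W0 : 0 <= W.
  by rewrite (le_trans _ (VW 0 _)) ?normr0.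
apply: contrapT => /forallNP unb.
(* Below this level K = 1/x is at least [1 + 6 * W], whence [3 * W * x <= 1/2] and [x <= 1]; the
   potential term of the constraint is then at most 1/2. *)
have [s0 [s00 ls0]] : exists s0, s0 <= 0 /\ l s0 < - (6 * W).
  have /existsNP[s0 /not_implyP[s00 /negP]] := unb (- (6 * W)).
  by rewrite -ltNge => ls0; exists s0.
have y12 s : s <= s0 -> 2^-1 <= y s ^+ 2.
  move=> ss0; have [|_ E pM] := H s; first exact: le_trans s00.
  have ls : l s <= - (6 * W) by rewrite (le_trans (lmono s s0 ss0))// ltW.
  have X0 : 0 < expR (l s) by exact: expR_gt0.
  have XK : expR (l s) * expR (- l s) = 1 by rewrite -expRD subrr expR0.
  have K1 : 1 + 6 * W <= expR (- l s).
    by apply: le_trans (expR_ge1Dx _); lra.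
  have XW : expR (l s) * (1 + 6 * W) <= 1 by rewrite -[leRHS]XK ler_wpM2l// ltW.
  have X1 : expR (l s) <= 1.
    have : 0 <= expR (l s) * W by rewrite mulr_ge0// ltW.
    lra.
  have VWs : V (phi s) <= W by apply: le_trans (ler_norm _) (VW _ pM).
  have yE : y s ^+ 2 = 1 - 3 * V (phi s) * expR (l s) ^+ 2.
    by have := constraint_normalized E; lra.
  rewrite yE.
  have h1 : V (phi s) * expR (l s) ^+ 2 <= W * expR (l s) ^+ 2.
    by rewrite ler_wpM2r// sqr_ge0.
  have h2 : W * expR (l s) ^+ 2 <= W * expR (l s).
    by rewrite ler_wpM2l// expr2 ler_piMr// ltW.
  lra.
(* Over a time [D] the square of the change of phi is at least [D ^+ 2 / 3], which exceeds
   [(2 * M) ^+ 2]. Working with squares avoids the sign of y. *)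
pose D := 4 * M + 4.
have D0 : 0 < D by rewrite /D; lra.
have sD : s0 - D < s0 by lra.
have [x xs|x xs E] := @mvt _ phi (fun s => b * y s) _ _ sD.
  by have [|] := H x; first lra.
have [|_ _ p1] := H (s0 - D); first lra.
have [|_ _ p2] := H s0; first lra.
have dM : `|phi s0 - phi (s0 - D)| <= 2 * M.
  by rewrite (le_trans (ler_normB _ _))//; lra.
have : (phi s0 - phi (s0 - D)) ^+ 2 <= (2 * M) ^+ 2.
  by rewrite -real_normK ?num_real// ler_pXn2r ?nnegrE ?mulr_ge0.
rewrite E.
have -> : (b * y x * (s0 - (s0 - D))) ^+ 2 = b ^+ 2 * (y x ^+ 2 * D ^+ 2) by ring.
rewrite sqrt23_sqr.
have : 2^-1 * D ^+ 2 <= y x ^+ 2 * D ^+ 2.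
  by rewrite ler_wpM2r ?sqr_ge0// y12//; lra.
have : D ^+ 2 = 16 * M ^+ 2 + 32 * M + 16 by rewrite /D; ring.
have -> : (2 * M) ^+ 2 = 4 * M ^+ 2 by ring.
have := sqr_ge0 M; lra.
Qed.

Lemma bounded_past_trapped (V : R -> R) (p : state R) (M : R) :
  (forall s, 0 <= V s) ->
  (forall x : R, is_derive x 1 V (derive1 V x)) ->
  (forall N : R, exists2 M, 0 <= M & (forall x, `|x| <= N -> `|V x| <= M) /\
    forall x y, `|x| <= N -> `|y| <= N -> `|V x - V y| <= M * `|x - y|) ->
  (forall N : R, exists2 M, 0 <= M & (forall x, `|x| <= N -> `|derive1 V x| <= M) /\
    forall x y, `|x| <= N -> `|y| <= N ->
      `|derive1 V x - derive1 V y| <= M * `|x - y|) ->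
  Omega V p -> (forall q, past_orbit V p q -> `|scalar_field q| <= M) ->
  exists n : nat, trapped V (derive1 V) n.+1%:R (chart p).
Proof.
move=> V0 VD VL dVL Op orbM0.
pose M' := Num.max M `|scalar_field p|.
have orbM q : past_orbit V p q -> `|scalar_field q| <= M'.
  by move=> /orbM0 qM; rewrite le_max qM.
have pM : `|scalar_field p| <= M' by rewrite le_max lexx orbT.
have [l [w [y [phi [lD w0 [l0 y0 phi0] H]]]]] := past_flow V0 VD dVL Op pM orbM.
have [W _ [VW _]] := VL M'.
have [|c cl] := @log_scale_lower_bound V l w y phi M' W lD w0 VW.
  by move=> s /H[].
have lmono (s t : R) : s <= t -> l s <= l t.
  by move=> st; apply: (derive_ge0_le st (fun x _ => lD x) (fun x _ => w0 x)).
have clT s : c <= l s.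
  have [/cl//|/ltW s0] := leP s 0; exact: le_trans (cl 0 (lexx _)) (lmono _ _ s0).
have cexp : continuous (fun s => expR (l s)).
  move=> s; apply: continuous_comp; first exact: is_derive_continuous (lD s).
  exact: continuous_expR.
(* [sg] is the time t as a function of tau, since dt/dtau = x. As x stays above [expR c], its
   inverse [g] reaches every [t <= 0]. *)
have [sg [sg0 sgD]] := continuous_primitive cexp.
have [|g [gK sgK gmono gD]] := @derive_gt0_inverse R sg _ _ (expR_gt0 c) sgD.
  by move=> s; rewrite ler_expR.
have g0 : g 0 = 0 by rewrite -[in LHS]sg0 sgK.
have gle t : t <= 0 -> g t <= 0.
  by rewrite le_eqVlt => /predU1P[->|t0]; rewrite ?g0// ltW// -[ltRHS]g0 gmono.
have k0 : 0 < hubble p by case: Op.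
(* The three terms bound phi, K and 1/K on the past; the last because K does not increase in time
   and so is at least [hubble p] there. *)
pose n := Num.bound (M' + expR (- c) + (hubble p)^-1).
have M'0 : 0 <= M' := le_trans (normr_ge0 _) pM.
have ec0 := expR_gt0 (- c).
have ki0 : 0 < (hubble p)^-1 by rewrite invr_gt0.
have nb : M' + expR (- c) + (hubble p)^-1 < n.+1%:R.
  have s0 : 0 <= M' + expR (- c) + (hubble p)^-1 by lra.
  by apply: lt_trans (archi_boundP s0) _; rewrite ltr_nat.
exists n, (phi \o g), (fun t => b * y (g t) * expR (- l (g t))), (fun t => expR (- l (g t))).
split; last first.
  rewrite /chart /= g0 y0 phi0 expRN l0 invrK; congr (_, _).
  by rewrite !mulrA (mulrC b) sqrt32_sqrt23 mul1r divfK// gt_eqF.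
move=> t t0; have s0 := gle t t0.
have [wE yD phiD E phiM] := H _ s0.
have Kinv : (expR (l (g t)))^-1 = expR (- l (g t)) by rewrite expRN.
have gDt : is_derive t 1 g (expR (- l (g t))) by rewrite -Kinv; exact: gD.
have XK : expR (l (g t)) * expR (- l (g t)) = 1 by rewrite -expRD subrr expR0.
split => /=.
- exact: (is_derive1_comp (f := phi)).
- have lDg := lD (g t); rewrite wE in lDg; have eD := is_derive_expRN lDg.
  pose v (s : R) := b * y s * expR (- l s).
  have vD : is_derive (g t) 1 v
      (- (b * y (g t) * expR (- l (g t))) - expR (l (g t)) * derive1 V (phi (g t))).
    apply: is_derive_eq; rewrite /GRing.scale/=.
    transitivity (- (b * y (g t) * expR (- l (g t))) - (a * b) * expR (l (g t)) *
      (expR (l (g t)) * expR (- l (g t))) * derive1 V (phi (g t))); first by ring.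
    by rewrite XK sqrt32_sqrt23 mul1r mulr1.
  have := is_derive1_comp (f := v) vD gDt.
  congr is_derive.
  transitivity (- (expR (- l (g t)) * (b * y (g t) * expR (- l (g t)))) -
    (expR (l (g t)) * expR (- l (g t))) * derive1 V (phi (g t))); first by ring.
  by rewrite XK mul1r.
- have -> : (b * y (g t) * expR (- l (g t))) ^+ 2 =
    b ^+ 2 * (y (g t) ^+ 2 * expR (- l (g t)) ^+ 2) by ring.
  by rewrite sqrt23_sqr; lra.
- apply/andP; split.
    apply: (@le_trans _ _ (hubble p)).
      rewrite -[leRHS]invrK lef_pV2 ?posrE//; lra.
    by rewrite -[leLHS]invrK -l0 -expRN ler_expR lerN2 lmono.
  apply: (@le_trans _ _ (expR (- c))); last by lra.
  by rewrite ler_expR lerN2.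
- by lra.
Qed.

End flow.

(** * The exceptional set as a countable union of null sets *)

Theorem theorem1 (R : realType) (V : R -> R)
    (V_ge0 : forall s : R, 0 <= V s) (V_C3 : Ck 3 V) :
  exists N : set (state R),
    [/\ N `<=` Omega V, measure_zero N
      & forall p : state R, Omega V p -> ~ N p ->
          ~ [bounded scalar_field q | q in past_orbit V p]].
Proof.
have [dV _] := V_C3.
have D0 (x : R) : is_derive x 1 V (derive1 V x).
  by rewrite derive1E; apply: DeriveDef => //; exact: (dV 0%N).
have D1 (x : R) : is_derive x 1 (derive1 V) (derive1n 2 V x).
  by rewrite /derive1n/= [X in is_derive _ _ _ X]derive1E; apply: DeriveDef => //; exact: (dV 1%N).
have D2 : continuous (derive1n 2 V).
  by move=> x; apply/differentiable_continuous/derivable1_diffP; exact: (dV 2%N).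
have VL N := continuous_derive_lipschitz N D0 (fun x => is_derive_continuous (D1 x)).
have dVL N := continuous_derive_lipschitz N D1 D2.
exists [set p | Omega V p /\ [bounded scalar_field q | q in past_orbit V p]].
split.
- by move=> p [].
- have : (@lebesgue_measure R \x @lebesgue_measure R)%E.-negligible
      (\bigcup_n trapped V (derive1 V) n.+1%:R).
    apply: negligible_bigcup => n.
    have [M1 M10 [_ VM]] := VL n.+1%:R.
    have [M2 M20 [_ dVM]] := dVL n.+1%:R.
    apply: (@trapped_negligible R V (derive1 V) n.+1%:R (M1 + M2)) => //.
    + by rewrite ler1n.
    + exact: addr_ge0.
    + by move=> x y xn yn; apply: le_trans (VM x y xn yn) _; rewrite ler_wpM2r// lerDl.
    + by move=> x y xn yn; apply: le_trans (dVM x y xn yn) _; rewrite ler_wpM2r// lerDr.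
  apply: negligibleS => _ [p [Op [M [_ HM]]] <-].
  have [n pn] : exists n : nat, trapped V (derive1 V) n.+1%:R (chart p).
    (* Boundedness provides a bound by every number greater than [M], hence by [M + 1]. *)
    apply: (@bounded_past_trapped R V p (M + 1)) => // q qp.
    by apply: HM => //; rewrite ltrDl.
  by exists n.
- by move=> p Op NN bd; apply: NN.
Qed.
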